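(* Let $d\ge1$, $T>0$, $\beta>0$, $V\in C^1(\mathbb{R}^d)$, and let $\rho_0$ be a probability density on $\mathbb{R}^d$ with finite second moment. Assume that for every $y\in\mathbb{R}^d$ $$\int_{\mathbb{R}^d}e^{-\frac{1}{2\beta}\left(V(z)+\frac{\|z-y\|^2}{2T}\right)}dz<+\infty.$$ Then the forward-backward PDE system $$\left\{\begin{aligned} &\partial_t\rho(t,x)+\nabla\cdot\big(\rho(t,x)\nabla_x\Phi(t,x)\big)=\beta\Delta_x\rho(t,x),\\ &\partial_t\Phi(t,x)+\tfrac12\|\nabla_x\Phi(t,x)\|^2=-\beta\Delta_x\Phi(t,x),\\ &\rho(0,x)=\rho_0(x),\quad \Phi(T,x)=-V(x), \end{aligned}\right.\qquad t\in[0,T],\ x\in\mathbb{R}^d,$$ has the solution $$\left\{\begin{aligned} &\rho(t,x)=\big(G_{T-t}*e^{-\frac{V}{2\beta}}\big)(x)\cdot\Big(G_t*\frac{\rho_0}{G_T*e^{-\frac{V}{2\beta}}}\Big)(x),\\ &\Phi(t,x)=2\beta\log\big(G_{T-t}*e^{-\frac{V}{2\beta}}\big)(x). \end{aligned}\right.$$ Consequently, for $0<t<T$, $$\rho(t,x)=\frac{1}{\left(4\pi\beta\frac{t(T-t)}{T}\right)^{\frac d2}}\int_{\mathbb{R}^d}\int_{\mathbb{R}^d}\frac{e^{-\frac{1}{2\beta}\left(V(z)+\frac{\|x-z\|^2}{2(T-t)}+\frac{\|x-y\|^2}{2t}\right)}}{\int_{\mathbb{R}^d}e^{-\frac{1}{2\beta}\left(V(\tilde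 y)+\frac{\|y-\tilde y\|^2}{2T}\right)}d\tilde y}\,\rho_0(y)\,dy\,dz,$$ and for $0\le t<T$, $$\Phi(t,x)=2\beta\log\Big(\int_{\mathbb{R}^d}\frac{1}{(4\pi\beta(T-t))^{\frac d2}}e^{-\frac{1}{2\beta}\left(V(y)+\frac{\|x-y\|^2}{2(T-t)}\right)}dy\Big).$$
   Context: $\|\cdot\|$ is the Euclidean norm. The scaled heat kernel is $G_t(x,y)=\frac{1}{\sqrt{(4\pi\beta t)^d}}e^{-\frac{\|x-y\|^2}{4\beta t}}$ for $t\in(0,T]$, and $(G_t*f)(x)=\int_{\mathbb{R}^d}G_t(x,y)f(y)\,dy$; by convention $G_0*f=f$. *)

(* Defs.v *)
(* The space R^d is 'rV[R]_d. *)
From HB Require Import structures.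
From mathcomp Require Import all_boot all_order all_algebra.
From mathcomp Require Import all_classical all_reals all_analysis.

Set Implicit Arguments.
Unset Strict Implicit.
Unset Printing Implicit Defensive.

Import Order.TTheory GRing.Theory Num.Theory.
Import numFieldNormedType.Exports.

Local Open Scope classical_set_scope.
Local Open Scope ring_scope.

(* The product (= Borel) sigma-algebra on R^n, as the library does for
   n.-tuple. *)
Section rV_measurable.
Context (R : realType) (n : nat).

Definition rV_coord (i : 'I_n) (x : 'rV[R]_n) : R := x ord0 i.

Let rV_set0 : g_sigma_preimage rV_coord set0.
Proof. exact: sigma_algebra0. Qed.

Let rV_setC A : g_sigma_preimage rV_coord A ->
  g_sigma_preimage rV_coord (~` A).
Proof. exact: sigma_algebraC. Qed.

Let rV_bigcup (F : _^nat) : (forall i, g_sigma_preimage rV_coord (F i)) ->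
  g_sigma_preimage rV_coord (\bigcup_i (F i)).
Proof. exact: sigma_algebra_bigcup. Qed.

HB.instance Definition _ := @isMeasurable.Build default_measure_display
  'rV[R]_n (g_sigma_preimage rV_coord) rV_set0 rV_setC rV_bigcup.

Lemma measurable_rV_coord i : measurable_fun [set: 'rV[R]_n] (rV_coord i).
Proof.
move=> _ Y mY; rewrite setTI; apply: sub_sigma_algebra => /=.
rewrite -bigcup_seq/=; exists i => /=; first by rewrite mem_index_enum.
by exists Y => //; rewrite setTI.
Qed.

Lemma measurable_fun_rVP d (T : measurableType d) (f : T -> 'rV[R]_n) :
  (forall i, measurable_fun setT (fun t => f t ord0 i)) ->
  measurable_fun setT f.
Proof.
move=> mf _ A mA; rewrite setTI.
suff : g_sigma_preimage rV_coord `<=` [set A | measurable (f @^-1` A)].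
  exact.
apply: smallest_sub => /=.
  split => //=.
  - by rewrite preimage_set0.
  - by move=> B mB; rewrite setTD preimage_setC; exact: measurableC.
  - by move=> F mF; rewrite preimage_bigcup; exact: bigcupT_measurable.
rewrite -bigcup_seq/= => B [i _ [C mC <-]] /=.
by rewrite setTI -comp_preimage -[X in measurable X]setTI; exact: mf.
Qed.

End rV_measurable.

Lemma sigma_finite_product d1 d2 (T1 : measurableType d1)
    (T2 : measurableType d2) (R : realType)
    (m1 : {sigma_finite_measure set T1 -> \bar R})
    (m2 : {sigma_finite_measure set T2 -> \bar R}) :
  sigma_finite setT (m1 \x m2)%E.
Proof.
have /sigma_finiteP[F [TF ndF Foo]] := sigma_finiteT m1.
have /sigma_finiteP[G [TG ndG Goo]] := sigma_finiteT m2.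
exists (fun n => F n `*` G n).
  rewrite -setXTT TF TG predeqE => -[x y]; split.
    move=> [/= [n _ Fnx] [k _ Gky]]; exists (maxn n k) => //; split.
    - by move: x Fnx; exact/subsetPset/ndF/leq_maxl.
    - by move: y Gky; exact/subsetPset/ndG/leq_maxr.
  by move=> [n _ []/= ? ?]; split; exists n.
move=> k; have [? ?] := Foo k; have [? ?] := Goo k.
split; first exact: measurableX.
by rewrite product_measure1E// lte_mul_pinfty// ge0_fin_numE.
Qed.

Section lebesgue_measure_rV.
Context (R : realType).

Definition rV_cons n (p : R * 'rV[R]_n) : 'rV[R]_n.+1 :=
  row_mx (p.1)%:M p.2 : 'rV[R]_(1 + n).

Definition rV_uncons n (x : 'rV[R]_n.+1) : R * 'rV[R]_n :=
  (x ord0 ord0, rsubmx (x : 'rV[R]_(1 + n))).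

Lemma rV_consK n : cancel (@rV_cons n) (@rV_uncons n).
Proof.
move=> [a x]; rewrite /rV_uncons /rV_cons row_mxKr; congr pair => /=.
transitivity (row_mx (a%:M : 'M[R]_1) x ord0 (lshift n ord0)).
  by congr (row_mx _ _ _ _); exact: val_inj.
by rewrite row_mxEl mxE eqxx mulr1n.
Qed.

Lemma rV_unconsK n : cancel (@rV_uncons n) (@rV_cons n).
Proof.
move=> x; rewrite /rV_cons /rV_uncons /=.
suff -> : (x ord0 ord0)%:M = lsubmx (x : 'rV[R]_(1 + n)).
  exact: (@hsubmxK _ 1 1 n x).
apply/rowP => i; rewrite !mxE [i]ord1 eqxx mulr1n.
by congr (x _ _); exact: val_inj.
Qed.

Lemma measurable_rV_cons n : measurable_fun setT (@rV_cons n).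
Proof.
apply: measurable_fun_rVP => i.
have [j ->|j ->] := split_ordP (i : 'I_(1 + n)).
  have -> : (fun p => @rV_cons n p ord0 (lshift n j)) = fst.
    by apply/funext => p /=; rewrite /rV_cons (@row_mxEl _ 1 1 n) mxE [j]ord1 eqxx mulr1n.
  exact: measurable_fst.
have -> : (fun p => @rV_cons n p ord0 (rshift 1 j)) =
    (@rV_coord R n j) \o snd.
  by apply/funext => p /=; rewrite /rV_cons (@row_mxEr _ 1 1 n).
apply: measurableT_comp; [exact: measurable_rV_coord|exact: measurable_snd].
Qed.

Lemma measurable_rV_uncons n : measurable_fun setT (@rV_uncons n).
Proof.
apply/measurable_fun_pairP; split.
  exact: (@measurable_rV_coord R n.+1 ord0).
apply: measurable_fun_rVP => i.
have -> : (fun t => (snd \o @rV_uncons n) t ord0 i) =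
    @rV_coord R n.+1 (rshift 1 i).
  by apply/funext => x; rewrite /= mxE.
exact: measurable_rV_coord.
Qed.

Section step.
Context n (m : {sigma_finite_measure set 'rV[R]_n -> \bar R}).

Definition lebesgue_rV_step : set 'rV[R]_n.+1 -> \bar R :=
  pushforward (lebesgue_measure \x m)%E (@rV_cons n).

Let step_measurable A : measurable A -> measurable (@rV_cons n @^-1` A).
Proof.
by move=> mA; rewrite -[X in measurable X]setTI; exact: measurable_rV_cons.
Qed.

Let step0 : lebesgue_rV_step set0 = 0%E.
Proof. by rewrite /lebesgue_rV_step /pushforward preimage_set0 measure0. Qed.

Let step_ge0 A : (0 <= lebesgue_rV_step A)%E.
Proof. by rewrite /lebesgue_rV_step /pushforward; exact: measure_ge0. Qed.

Let step_sigma_additive : semi_sigma_additive lebesgue_rV_step.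
Proof.
move=> F mF tF mUF; rewrite /lebesgue_rV_step /pushforward preimage_bigcup.
apply: measure_semi_sigma_additive.
- by move=> k; exact: step_measurable.
- apply/trivIsetP => /= i j _ _ ij; rewrite -preimage_setI.
  by move/trivIsetP : tF => /(_ _ _ _ _ ij) ->//; rewrite preimage_set0.
- by rewrite -preimage_bigcup; exact: step_measurable.
Qed.

HB.instance Definition _ := isMeasure.Build _ _ _ lebesgue_rV_step
  step0 step_ge0 step_sigma_additive.

Let step_sigma_finite : sigma_finite setT lebesgue_rV_step.
Proof.
have [F TF Foo] := sigma_finite_product
  (lebesgue_measure : {sigma_finite_measure set (measurableTypeR R) -> \bar R})
  m.
exists (fun k => @rV_uncons n @^-1` F k).
  by rewrite -preimage_bigcup -TF preimage_setT.
move=> k; have [mF Fk] := Foo k; split.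
  by rewrite -[X in measurable X]setTI; exact: measurable_rV_uncons.
rewrite /lebesgue_rV_step /pushforward -comp_preimage.
by rewrite (_ : _ \o _ = id) ?preimage_id//; exact/funext/rV_consK.
Qed.

HB.instance Definition _ := Measure_isSigmaFinite.Build _ _ _ lebesgue_rV_step
  step_sigma_finite.

End step.

(* Lebesgue measure on R^d, the d-fold product of lebesgue_measure; on R^0 it
   is the unit mass. *)
Fixpoint lebesgue_rV (d : nat) : {sigma_finite_measure set 'rV[R]_d -> \bar R} :=
  if d is n.+1 then lebesgue_rV_step (lebesgue_rV n) else \d_(0 : 'rV[R]_0).

End lebesgue_measure_rV.

Section differential_operators.
Context (R : realType) (d : nat).
Implicit Types (f : 'rV[R]_d -> R) (F : 'rV[R]_d -> 'rV[R]_d).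

(* The library norm on 'rV[R]_d is the sup norm; it induces the same topology. *)
Definition enorm (x : 'rV[R]_d) : R := Num.sqrt (\sum_i x ord0 i ^+ 2).

Definition unit_rV (i : 'I_d) : 'rV[R]_d := delta_mx ord0 i.

Definition grad f (x : 'rV[R]_d) : 'rV[R]_d := \row_i 'D_(unit_rV i) f x.

Definition divergence F (x : 'rV[R]_d) : R :=
  \sum_i 'D_(unit_rV i) (fun y => F y ord0 i) x.

Definition laplacian f (x : 'rV[R]_d) : R := divergence (grad f) x.

Definition continuously_differentiable f : Prop :=
  (forall x, differentiable f x) /\ continuous (grad f).

(* u is of class C^{1,2} (once in t, twice in x) on ]0, T[ x R^d. *)
Definition is_C12 (T : R) (u : R -> 'rV[R]_d -> R) : Prop :=
  forall (t : R) (x : 'rV[R]_d), 0 < t < T ->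
  [/\ [/\ derivable (fun s => u s x) t 1,
          forall i, derivable (u t) x (unit_rV i) &
          forall i j, derivable (fun y => grad (u t) y ord0 i) x (unit_rV j)],
      {for (t, x), continuous (fun p : R * 'rV[R]_d => u p.1 p.2)},
      {for (t, x), continuous
         (fun p : R * 'rV[R]_d => derive1 (fun s => u s p.2) p.1)},
      forall i, {for (t, x), continuous
         (fun p : R * 'rV[R]_d => grad (u p.1) p.2 ord0 i)} &
      forall i j, {for (t, x), continuous
         (fun p : R * 'rV[R]_d =>
            'D_(unit_rV j) (fun y => grad (u p.1) y ord0 i) p.2)}].

End differential_operators.

Section heat_kernel.
Context (R : realType) (d : nat).

Definition probability_density (f : 'rV[R]_d -> R) : Prop :=
  [/\ measurable_fun setT f, forall x, 0 <= f x &
      (\int[lebesgue_rV R d]_x (f x)%:E = 1)%E].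

Definition finite_second_moment (f : 'rV[R]_d -> R) : Prop :=
  (\int[lebesgue_rV R d]_x (enorm x ^+ 2 * f x)%:E < +oo)%E.

(* Meaningful for 0 < t only. *)
Definition heat_kernel (beta t : R) (x y : 'rV[R]_d) : R :=
  (Num.sqrt ((4 * pi * beta * t) ^+ d))^-1 *
  expR (- (enorm (x - y) ^+ 2 / (4 * beta * t))).

(* G_t * f, with G_0 * f = f; the integral is the real-valued Rintegral, so it
   is meaningful when heat_conv_integrable holds. *)
Definition heat_conv (beta t : R) (f : 'rV[R]_d -> R) (x : 'rV[R]_d) : R :=
  if t == 0 then f x
  else \int[lebesgue_rV R d]_y (heat_kernel beta t x y * f y).

Definition heat_conv_integrable (beta t : R) (f : 'rV[R]_d -> R)
    (x : 'rV[R]_d) : Prop :=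
  t != 0 ->
  (lebesgue_rV R d).-integrable setT
    (EFin \o (fun y => heat_kernel beta t x y * f y)).

(* Classical solution on [0, T] of the forward-backward system.  The equations
   are required on the open time interval.  The end point conditions are
   required literally, and also as limits: Phi is continuous up to both end
   points, rho is continuous up to T, and, rho0 being an arbitrary density,
   rho t tends to rho0 at 0 in the sense of weak convergence of measures. *)
Definition is_solution (T beta : R) (V rho0 : 'rV[R]_d -> R)
    (rho Phi : R -> 'rV[R]_d -> R) : Prop :=
  [/\ is_C12 T rho /\ is_C12 T Phi,
      forall (t : R) (x : 'rV[R]_d), 0 < t < T ->
        derive1 (fun s => rho s x) t
          + divergence (fun y => rho t y *: grad (Phi t) y) x
        = beta * laplacian (rho t) x
        /\
        derive1 (fun s => Phi s x) t + 2^-1 * enorm (grad (Phi t) x) ^+ 2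
        = - (beta * laplacian (Phi t) x),
      forall x, rho 0 x = rho0 x /\ Phi T x = - V x,
      {within `]0, T] `*` [set: 'rV[R]_d],
         continuous (fun p : R * 'rV[R]_d => rho p.1 p.2)} /\
      {within `[0, T] `*` [set: 'rV[R]_d],
         continuous (fun p : R * 'rV[R]_d => Phi p.1 p.2)} &
      forall f : 'rV[R]_d -> R, continuous f ->
        (exists M : R, forall x, `|f x| <= M) ->
        (\int[lebesgue_rV R d]_x (f x * rho t x)) @[t --> 0^'+] -->
        \int[lebesgue_rV R d]_x (f x * rho0 x)].

End heat_kernel.

(* Main.v *)
Require Import Defs.
From mathcomp Require Import all_boot all_order all_algebra.
From mathcomp Require Import all_classical all_reals all_analysis.
From mathcomp Require Import measurable_realfun ring lra.
Import Order.TTheory GRing.Theory Num.Theory.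
Import numFieldNormedType.Exports.
Local Open Scope classical_set_scope.
Local Open Scope ring_scope.

(* Put g = exp(-V/(2 beta)), psi_t = G_(T-t) * g and phi_t = G_t * h, where
   h = rho0 / (G_T * g).  Then psi solves the backward and phi the forward heat
   equation, and rho = psi phi, Phi = 2 beta ln psi turn these two linear
   equations into the system (Hopf-Cole transformation).

   Differentiation under the integral sign is needed only for the exponential
   families s |-> \int exp(s m(y)) F(y) dy: a Gaussian integral is one in the
   inverse time (m = squared distance) and, up to an explicit factor, in each
   space direction (m affine).  The derivatives are then Gaussian integrals of
   F multiplied by coordinates, and remain finite since all translates are.

   Finiteness of G_t * h up to t = T rests on the bound G_T * g (y) >= C_x G_T(x, y),
   which follows by integrating g over a small cube adjacent to x in the
   direction of y.

   For the weak limit at t = 0, Fubini gives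
     \int f rho_t = \int \int h(y) G_T(y, z) g(z) (G_tau * f)(m) dz dy,
   with tau = t (T - t) / T and m = (t z + (T - t) y) / T (Brownian bridge), to
   which dominated convergence applies. *)

Set Implicit Arguments.
Unset Strict Implicit.
Unset Printing Implicit Defensive.

(** * Topology and Lebesgue measure on row vectors *)

(** Integrability is known at one rate only. The hypothesis on V says that [g] has finite Gaussian
    integrals at rate (4 beta T)^-1 about every centre; nothing is known at smaller rates, that is,
    beyond time T. [gadm] records exactly this. It passes to larger rates, hence to earlier times,
    so that the whole analysis runs on [gadm (rate T) g] and [gadm (rate T) h]. Space derivatives
    cost nothing: moving the centre tilts the Gaussian at the same rate. The time derivative asks
    for admissibility at a strictly smaller rate, hence for a time below T. Continuity up to T has
    no such room and needs a majorant of rate exactly [rate T] ([corners]).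

    [h] is neither bounded nor continuous in general; only its product with G_T * g, which is rho0,
    is under control. This is why the weak limit at 0 is not read off from G_t * h: the masses are
    regrouped so that the short-time kernel falls on the bounded continuous test function and a
    multiple of rho0 dominates.

    Limits are reduced to sequences in order to apply dominated convergence. *)

Lemma cvg_within_seq (R : realType) (T : pseudoMetricType R)
    (S : topologicalType) (A : set T) (f : T -> S) (p : T) (l : S) :
  (forall u : nat -> T, (forall n, A (u n)) -> u @ \oo --> p ->
    f (u n) @[n --> \oo] --> l) ->
  f x @[x --> within A (nbhs p)] --> l.
Proof.
(* If the limit failed, each ball of radius 1/(n+1) around [p] would contain a point of [A] sent
   outside [U]; a choice of such points is a sequence contradicting [fl]. *)
move=> fl U Ul; apply: contrapT => nU.
have {}nU n : exists x, [/\ ball p n.+1%:R^-1 x, A x & ~ U (f x)].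
  apply: contrapT => /forallNP h; apply: nU.
  rewrite /= /within /=; apply/nbhs_ballP; exists n.+1%:R^-1 => /=.
    by rewrite invr_gt0.
  move=> x px Ax; apply: contrapT => nUx; exact: (h x).
have [u /all_and3[pu Au nUu]] := choice nU.
have up : u @ \oo --> p.
  apply/cvg_ballP => e e0; near=> n; apply: (@le_ball _ _ _ n.+1%:R^-1) (pu n).
  by apply: ltW; near: n; exact: near_infty_natSinv_lt (PosNum e0).
have [N _ NU] := fl u Au up U Ul.
by apply: (nUu N); exact: (NU N (leqnn N)).
Unshelve. all: by end_near. Qed.

Section rV_topology.
Context (R : realType) (d : nat).
Local Notation rV := 'rV[R]_d.
Implicit Types x y : 'rV[R]_d.

Lemma ball_rVE x e y :
  ball x e y <-> 0 < e /\ forall i, `|x ord0 i - y ord0 i| < e.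
Proof.
split=> [[e0 xy]|[e0 xy]]; split=> // i; first exact: (xy ord0 i).
by move=> j; rewrite [i]ord1; exact: xy.
Qed.

Lemma cvg_rV_coord {T} {F : set_system T} {FF : Filter F} (f : T -> rV) (l : rV) i :
  f @ F --> l -> (f t ord0 i) @[t --> F] --> l ord0 i.
Proof.
by move=> fl; apply: (cvg_comp f (fun M : rV => M ord0 i) fl); exact: coord_continuous.
Qed.

Lemma cvg_rV {T} {F : set_system T} {FF : Filter F} (f : T -> rV) (l : rV) :
  (forall i, (f t ord0 i) @[t --> F] --> l ord0 i) -> f @ F --> l.
Proof.
move=> fl; apply/cvg_ballP => e e0.
apply: (@filterS _ _ _ (fun t => forall i, `|l ord0 i - f t ord0 i| < e)).
  by move=> t h; apply/ball_rVE; split.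
by apply: filter_forall => i; move/cvgrPdist_lt: (fl i); exact.
Qed.

Lemma measurable_ball_rV x e : measurable (ball x e : set rV).
Proof.
have [e0|e0] := ltP 0 e; last first.
  rewrite (_ : ball x e = set0)//; apply/seteqP; split => // y /ball_rVE[].
  by rewrite ltNge e0.
have -> : (ball x e : set rV) =
    \bigcap_(i in [set` enum 'I_d]) ((fun y : rV => rV_coord i y) @^-1` ball (x ord0 i) e).
  apply/seteqP; split => y /=; first by move=> /ball_rVE[_ xy] i _; exact: xy.
  by move=> xy; apply/ball_rVE; split => // i; apply: xy; rewrite /= mem_enum.
apply: fin_bigcap_measurable; first exact: finite_seq.
move=> i _; rewrite -[X in measurable X]setTI.
by apply: measurable_rV_coord => //; apply: open_measurable; exact: ball_open.
Qed.

(** The sigma-algebra is generated by the coordinates, so openness has to be turned into countable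
    data: an open set is the union of the balls with rational centre and radius 1/(n+1) that it
    contains. *)
Lemma open_measurable_rV (U : set rV) : open U -> measurable U.
Proof.
move=> oU.
pose c (p : 'rV[rat]_d * nat) : set rV :=
  ball (map_mx ratr p.1 : rV) p.2.+1%:R^-1.
have -> : U = \bigcup_p (if `[< c p `<=` U >] then c p else set0).
  apply/seteqP; split => [x Ux|x [p _]]; last by case: ifPn => // /asboolP; exact.
  have /nbhs_ballP[e /= e0 eU] : nbhs x U by move: oU; rewrite openE; exact.
  (* A radius below e / 2 and a rational centre closer to [x] than that radius: the ball contains
     [x] and, by the triangle inequality, stays within e of [x]. *)
  have [n ne] : exists n : nat, n.+1%:R^-1 < e / 2.
    have [n _ /(_ n (leqnn n))] :=
      near_infty_natSinv_lt (PosNum (divr_gt0 e0 (ltr0n R 2))).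
    by exists n.
  have n0 : 0 < n.+1%:R^-1 :> R by rewrite invr_gt0.
  have /choice[q xq] i : exists q : rat, `|x ord0 i - ratr q| < n.+1%:R^-1.
    have xn : x ord0 i < x ord0 i + n.+1%:R^-1 by rewrite ltrDl.
    have [q] := rat_in_itvoo xn; rewrite in_itv/= => /andP[xq qx].
    by exists q; rewrite distrC gtr0_norm ?subr_gt0// ltrBlDl.
  exists (\row_i q i, n) => //; case: ifPn => [_|/asboolP[]].
    by apply/ball_rVE; split => // i; rewrite !mxE distrC.
  move=> y /ball_rVE[_ qy]; apply: eU; apply/ball_rVE; split => // i.
  rewrite (le_lt_trans (ler_distD (ratr (q i)) _ _))//.
  by rewrite [ltRHS]splitr ltrD// (lt_trans _ ne)//; have := qy i; rewrite !mxE.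
apply: countable_bigcupT_measurable => [|p]; first exact: countableP.
by case: ifPn => // _; exact: measurable_ball_rV.
Qed.

Lemma continuous_measurable_rV (f : rV -> R) :
  continuous f -> measurable_fun setT f.
Proof.
move=> cf; apply: (measurability _ (RGenOpens.measurableE R)) => _ [_ [a [b ->] <-]].
rewrite setTI; apply: open_measurable_rV; move/continuousP: cf; apply.
exact: interval_open.
Qed.
End rV_topology.

(** * Integrals over R^d, one coordinate at a time *)

Section rV_integral.
Context (R : realType).
Local Notation leb := (lebesgue_rV R).

Lemma ge0_integral_lebesgue_rVS n (f : 'rV[R]_n.+1 -> \bar R) :
  measurable_fun setT f -> (forall x, 0 <= f x)%E ->
  (\int[leb n.+1]_x f x =
   \int[lebesgue_measure]_a \int[leb n]_x f (rV_cons (a, x)))%E.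
Proof.
move=> mf f0; transitivity (\int[pushforward (lebesgue_measure \x leb n)%E (@rV_cons R n)]_x f x)%E.
  by [].
rewrite ge0_integral_pushforward//=; last exact: measurable_rV_cons.
rewrite preimage_setT.
apply: (@fubini_tonelli1 _ _ _ _ _ (@lebesgue_measure R) (leb n) (f \o @rV_cons R n)) => //.
- by apply: measurableT_comp => //; exact: measurable_rV_cons.
- by move=> x; exact: f0.
Qed.

(** Tonelli and induction on d; for d = 0 both sides are 1, by the unit mass on R^0. It gives the
    mass of the heat kernel and the volume of a cube. *)
Lemma integral_prod_rV d (k : 'I_d -> R -> R) :
  (forall i, measurable_fun setT (k i)) -> (forall i x, 0 <= k i x) ->
  (\int[leb d]_y (\prod_i k i (y ord0 i))%:E =
   \prod_i \int[lebesgue_measure]_x (k i x)%:E)%E.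
Proof.
elim: d k => [|d IH] k mk k0.
  rewrite big_ord0 /= integral_dirac//; last first.
    rewrite [X in measurable_fun _ X](_ : _ = cst 1%E)//.
    by apply/funext => y; rewrite big_ord0.
  by rewrite big_ord0 diracT mul1e.
have mkc i (n := d.+1) : measurable_fun setT (fun y : 'rV[R]_n => k i (y ord0 i)).
  by apply: (measurableT_comp (mk i)); exact: measurable_rV_coord.
rewrite ge0_integral_lebesgue_rVS; last 2 first.
- by apply/measurable_EFinP; apply: measurable_prod => i _; exact: mkc.
- by move=> x; rewrite lee_fin prodr_ge0.
rewrite big_ord_recl -IH//.
rewrite -ge0_integralZr//; last 3 first.
- by apply/measurable_EFinP; exact: mk.
- by move=> x _; rewrite lee_fin.
- by apply: integral_ge0 => x _; rewrite lee_fin prodr_ge0.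
apply: eq_integral => a _; rewrite -ge0_integralZl//; last 3 first.
- apply/measurable_EFinP; apply: measurable_prod => i _.
  by apply: (measurableT_comp (mk _)); exact: measurable_rV_coord.
- by move=> x _; rewrite lee_fin prodr_ge0.
- by rewrite lee_fin.
apply: eq_integral => x _; rewrite -EFinM big_ord_recl; congr (_ * _)%:E.
  by have := rV_consK (a, x) => /(congr1 fst)/= ->.
apply: eq_bigr => i _.
have xE : rsubmx (@rV_cons R d (a, x) : 'rV[R]_(1 + d)) = x.
  exact: (congr1 snd (rV_consK (a, x))).
rewrite -[in RHS]xE [in RHS]mxE.
by congr (k _ (@rV_cons R d (a, x) ord0 _)); exact: val_inj.
Qed.
End rV_integral.

(** * Exponential families *)

Lemma expR_norm_le (R : realType) (a : R) : expR `|a| <= expR a + expR (- a).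
Proof.
by have [a0|a0] := ger0P a; rewrite ?lerDl ?lerDr expR_ge0.
Qed.

Section exponential_family.
Context (R : realType) d (Y : measurableType d) (mu : {measure set Y -> \bar R}).
Variables (m F : Y -> R) (u v : R).
Hypothesis mm : measurable_fun setT m.
Hypothesis intF : forall s, u < s < v ->
  mu.-integrable setT (EFin \o (fun y => expR (s * m y) * F y)).
Variable (s0 : R).
Hypothesis s0I : u < s0 < v.

(** A third of the distance from [s0] to the ends of the interval, so that the parameters s0 + 2e
    and s0 - 2e of the majorant are still admissible. *)
Let e := Num.min (s0 - u) (v - s0) / 3.

Let e0 : 0 < e.
Proof. by case/andP: s0I => us sv; rewrite divr_gt0// lt_min !subr_gt0 us. Qed.

Let eI s : `|s - s0| <= 2 * e -> u < s < v.
Proof.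
case/andP: s0I => us sv; have : 2 * e < Num.min (s0 - u) (v - s0).
  by move: e0; rewrite /e; lra.
by rewrite lt_min ler_norml => /andP[? ?] /andP[? ?]; apply/andP; split; lra.
Qed.

(* |m| exp(s m) <= (exp((s0 + 2e) m) + exp((s0 - 2e) m)) / e for |s - s0| < e. *)
Let G y := e^-1 * (`|expR ((s0 + 2 * e) * m y) * F y| +
                   `|expR ((s0 - 2 * e) * m y) * F y|).

Let integrableG : mu.-integrable setT (EFin \o G).
Proof.
rewrite (_ : EFin \o G = (fun y => e^-1%:E * (`|(expR ((s0 + 2 * e) * m y) * F y)%:E| +
    `|(expR ((s0 - 2 * e) * m y) * F y)%:E|))%E); last first.
  by apply/funext => y; rewrite /= -EFinD -EFinM.
have e20 : 0 <= 2 * e by rewrite mulr_ge0 ?ltW.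
apply: integrableZl => //; apply: integrableD => //; apply: integrable_abse; apply: intF; apply: eI.
  by rewrite addrAC subrr add0r ger0_norm.
by rewrite addrAC subrr add0r normrN ger0_norm.
Qed.

Let G_ub s y : `|s - s0| < e -> `|m y * (expR (s * m y) * F y)| <= G y.
Proof.
rewrite /G; move: (e) e0 => r r0 se; rewrite !normrM !(ger0_norm (expR_ge0 _)) -mulrDl !mulrA.
apply: ler_wpM2r => //.
(* One factor exp(e |m|) absorbs |m|, another absorbs the move from [s0] to [s]. This is where the
   2e of the majorant comes from; the sign of m is then removed by [expR_norm_le]. *)
have h1 : `|m y| <= r^-1 * expR (r * `|m y|).
  by rewrite ler_pdivlMl// (le_trans _ (expR_ge1Dx _))// lerDr.
have h2 : expR (s * m y) <= expR (s0 * m y) * expR (r * `|m y|).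
  rewrite -expRD ler_expR -lerBlDl -mulrBl (le_trans (ler_norm _))// normrM.
  by rewrite ler_wpM2r// ltW.
apply: (le_trans (ler_pM _ _ h1 h2)); rewrite ?expR_ge0//.
rewrite -!mulrA ler_pM2l ?invr_gt0// [leLHS]mulrCA.
rewrite mulrDl [(s0 - _) * _]mulrDl mulNr !expRD -mulrDr ler_pM2l ?expR_gt0// -expRD.
rewrite (le_trans _ (expR_norm_le _))// ler_expR !normrM (gtr0_norm r0) normr_nat.
by lra.
Qed.

Let mF : measurable_fun setT (fun y => expR (s0 * m y) * F y).
Proof. by have /measurable_int/measurable_EFinP := intF s0I. Qed.

Lemma exp_family_integrable :
  mu.-integrable setT (EFin \o (fun y => m y * (expR (s0 * m y) * F y))).
Proof.
apply: (le_integrable measurableT) integrableG => //=.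
- by apply/measurable_EFinP; apply: measurable_funM.
- move=> y _; rewrite lee_fin (le_trans (G_ub _ _))// ?subrr ?normr0//.
  by rewrite ler_norm.
Qed.

Lemma exp_family_derive :
  is_derive s0 (1 : R) (fun s => \int[mu]_y (expR (s * m y) * F y))
    (\int[mu]_y (m y * (expR (s0 * m y) * F y))).
Proof.
pose f s y := expR (s * m y) * F y.
have df s y : is_derive s (1 : R) (f ^~ y) (m y * (expR (s * m y) * F y)).
  rewrite /f; apply: is_derive_eq.
  by rewrite /GRing.scale/= ?mulr1 ?mul1r ?scaler0 ?addr0; ring.
have p1 s y : partial1of2 f s y = m y * (expR (s * m y) * F y).
  by rewrite partial1of2E; exact: derive_val.
have eE a : `]s0 - e, s0 + e[%classic a -> `|a - s0| < e.
  by rewrite /= in_itv/= ltr_distl.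
have h1 : `]s0 - e, s0 + e[%classic s0.
  by rewrite /= in_itv/= gtrBl ltrDl e0.
have h2 a : `]s0 - e, s0 + e[%classic a -> mu.-integrable setT (EFin \o f a).
  move=> /eE ae; apply/intF/eI/ltW/(lt_le_trans ae).
  by rewrite mulr_natl mulr2n lerDl ltW.
have h3 a y : `]s0 - e, s0 + e[%classic a -> setT y -> derivable (f ^~ y) a 1.
  by move=> _ _; exact: ex_derive.
have h4 y : 0 <= G y by rewrite mulr_ge0 ?addr_ge0// invr_ge0 ltW.
have h5 a y : `]s0 - e, s0 + e[%classic a -> setT y ->
    `|partial1of2 f a y| <= G y.
  by move=> /eE ae _; rewrite p1; exact: G_ub.
apply: DeriveDef.
  exact: (derivable_under_integral measurableT h1 h2 h3 h4 integrableG h5).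
rewrite -derive1E (differentiation_under_integral measurableT h1 h2 h3 h4 integrableG h5).
by apply: eq_Rintegral => y _; exact: p1.
Qed.
End exponential_family.

(** * Gaussian integrals *)

Lemma cvg_bigsum (R : realType) T (F : set_system T) (FF : Filter F) I
    (r : seq I) (f : I -> T -> R) (l : I -> R) :
  (forall i, f i t @[t --> F] --> l i) ->
  \sum_(i <- r) f i t @[t --> F] --> \sum_(i <- r) l i.
Proof. by move=> fl; apply: cvg_big => // p; exact: add_continuous. Qed.

Section gauss_weight.
Context (R : realType) (d : nat).
Local Notation rV := 'rV[R]_d.
Local Notation leb := (lebesgue_rV R d).
Implicit Types (x y : rV) (F : rV -> R) (c : R).

Definition sqdist x y : R := \sum_i (x ord0 i - y ord0 i) ^+ 2.

Lemma sqdist_ge0 x y : 0 <= sqdist x y.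
Proof. by apply: sumr_ge0 => i _; exact: sqr_ge0. Qed.

Lemma enorm_sqdist x y : enorm (x - y) ^+ 2 = sqdist x y.
Proof.
rewrite /enorm sqr_sqrtr; last by apply: sumr_ge0 => i _; exact: sqr_ge0.
by apply: eq_bigr => i _; rewrite !mxE.
Qed.

Lemma sqdistC x y : sqdist x y = sqdist y x.
Proof. by apply: eq_bigr => i _; ring. Qed.

Lemma measurable_sqdist : measurable_fun setT (fun p : rV * rV => sqdist p.1 p.2).
Proof.
apply: measurable_sum => i; apply: measurable_funX; apply: measurable_funB.
  exact: (measurableT_comp (@measurable_rV_coord R d i) measurable_fst).
exact: (measurableT_comp (@measurable_rV_coord R d i) measurable_snd).
Qed.

Lemma cvg_sqdist (x_ : nat -> rV) x y :
  x_ @ \oo --> x -> sqdist (x_ n) y @[n --> \oo] --> sqdist x y.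
Proof.
move=> xx; apply: cvg_bigsum => i; apply: (continuous_cvg _ (@exprn_continuous _ 2 _)); apply: cvgB; last exact: cvg_cst.
exact: cvg_rV_coord.
Qed.

Definition gauss c x y : R := expR (- (c * sqdist x y)).

Lemma gauss_ge0 c x y : 0 <= gauss c x y.
Proof. exact: expR_ge0. Qed.

Lemma gaussC c x y : gauss c x y = gauss c y x.
Proof. by rewrite /gauss sqdistC. Qed.

Lemma gauss_prod c x y :
  gauss c x y = \prod_i expR (- (c * (x ord0 i - y ord0 i) ^+ 2)).
Proof. by rewrite -expR_sum /gauss mulr_sumr sumrN. Qed.

Lemma le_gauss c c' x y : c <= c' -> gauss c' x y <= gauss c x y.
Proof. by move=> cc; rewrite ler_expR lerN2 ler_wpM2r// sqdist_ge0. Qed.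

Lemma measurable_gauss c : measurable_fun setT (fun p : rV * rV => gauss c p.1 p.2).
Proof.
apply: measurableT_comp => //; apply: measurableT_comp => //.
apply: measurable_funM => //; exact: measurable_sqdist.
Qed.

Lemma measurable_gaussr c x : measurable_fun setT (gauss c x).
Proof. exact: (measurableT_comp (measurable_gauss c) (measurable_pair1 x)). Qed.

Lemma cvg_gauss (c_ : nat -> R) (x_ : nat -> rV) c x y :
  c_ @ \oo --> c -> x_ @ \oo --> x ->
  gauss (c_ n) (x_ n) y @[n --> \oo] --> gauss c x y.
Proof.
move=> cc xx; apply: continuous_cvg; first exact: continuous_expR.
by apply: cvgN; apply: cvgM => //; exact: cvg_sqdist.
Qed.

(* A majorant of z |-> gauss c z y on the unit cube around x that keeps the same
   rate c: integrability is only available up to the final time. *)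
Definition corner x (b : {ffun 'I_d -> bool}) : rV :=
  \row_i (x ord0 i + (-1) ^+ b i).

Definition corners c x y : R := expR c ^+ d * \sum_b gauss c (corner x b) y.

(** One coordinate at a time: if y <= x, replacing x' by x - 1 raises the squared distance to y by
    at most 1, and if y > x the same holds for x + 1. Each coordinate thus costs a factor exp(c),
    and summing over both signs avoids having to know the side of y. *)
Lemma gauss_le_corners c x x' y : 0 <= c ->
  (forall i, `|x ord0 i - x' ord0 i| <= 1) -> gauss c x' y <= corners c x y.
Proof.
move=> c0 xx'; rewrite /corners gauss_prod.
have -> : \sum_b gauss c (corner x b) y =
    \prod_i \sum_(b : bool) expR (- (c * (x ord0 i + (-1) ^+ b - y ord0 i) ^+ 2)).
  rewrite bigA_distr_bigA; apply: eq_bigr => b _; rewrite gauss_prod.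
  by apply: eq_bigr => i _; rewrite mxE.
have -> : expR c ^+ d = \prod_(i < d) expR c by rewrite prodr_const card_ord.
rewrite -big_split/=.
apply: ler_prod => i _; rewrite expR_ge0/=.
rewrite big_bool/= expr1 expr0 mulrDr -!expRD.
have := xx' i; rewrite ler_norml => /andP[xl xu].
have [yx|xy] := leP (y ord0 i) (x ord0 i).
  apply: ler_wpDr; rewrite ?expR_ge0// ler_expR.
  have : 0 <= c * ((x' ord0 i - y ord0 i) ^+ 2 + 1 - (x ord0 i + -1 - y ord0 i) ^+ 2).
    rewrite mulr_ge0// (_ : _ - _ = (x ord0 i - x' ord0 i) ^+ 2 +
      2 * ((x ord0 i - y ord0 i) * (1 - (x ord0 i - x' ord0 i)))); last by ring.
    by rewrite addr_ge0 ?sqr_ge0 ?mulr_ge0 ?subr_ge0.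
  by lra.
apply: ler_wpDl; rewrite ?expR_ge0// ler_expR.
have : 0 <= c * ((x' ord0 i - y ord0 i) ^+ 2 + 1 - (x ord0 i + 1 - y ord0 i) ^+ 2).
  rewrite mulr_ge0// (_ : _ - _ = (x ord0 i - x' ord0 i) ^+ 2 +
    2 * ((y ord0 i - x ord0 i) * (x ord0 i - x' ord0 i - - 1))); last by ring.
  by rewrite addr_ge0 ?sqr_ge0 ?mulr_ge0 ?subr_ge0// ltW.
by lra.
Qed.

(* The finiteness is required at all x: this is what makes the class stable
   under multiplication of F by coordinates (gadm_mom). *)
Definition gadm c F := measurable_fun setT F /\
  forall x, leb.-integrable setT (EFin \o (fun y => gauss c x y * F y)).

Lemma gadm_le c c' F : c <= c' -> gadm c F -> gadm c' F.
Proof.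
move=> cc [mF iF]; split => // x.
apply: (le_integrable measurableT) (iF x) => /=.
  by apply/measurable_EFinP; apply: measurable_funM => //; exact: measurable_gaussr.
move=> y _; rewrite lee_fin !normrM !(ger0_norm (gauss_ge0 _ _ _)).
by rewrite ler_wpM2r// le_gauss.
Qed.

Lemma integrable_corners c x F : gadm c F ->
  leb.-integrable setT (EFin \o (fun y => corners c x y * F y)).
Proof.
move=> [mF iF]; rewrite (_ : _ \o _ = (fun y => (expR c ^+ d)%:E *
    \sum_(b : {ffun 'I_d -> bool}) (gauss c (corner x b) y * F y)%:E)%E).
  by apply: integrableZl => //; apply: integrable_sum => // b _; exact: iF.
by apply/funext => y; rewrite sumEFin -EFinM /= /corners -mulrA -mulr_suml.
Qed.

Definition gint c x F : R := \int[leb]_y (gauss c x y * F y).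

(** Dominated convergence with the majorant [corners] at the lowest rate [c0]. The limit [c] may
    equal [c0], which is what gives continuity up to the final time. *)
Lemma cvg_gint c0 F (c_ : nat -> R) (x_ : nat -> rV) c x :
  0 <= c0 -> gadm c0 F -> (forall n, c0 <= c_ n) ->
  c_ @ \oo --> c -> x_ @ \oo --> x ->
  gint (c_ n) (x_ n) F @[n --> \oo] --> gint c x F.
Proof.
move=> c00 aF cc0 cc xx.
(* The majorant is valid once the centres lie in the unit cube around [x]; the terms before [N] are
   dropped. *)
have [N _ xN] : \forall n \near \oo, forall i, `|x ord0 i - x_ n ord0 i| <= 1.
  by move/cvg_ballP: xx => /(_ 1 ltr01); apply: filterS => n /ball_rVE[_ h] i; exact/ltW.
have c0c : c0 <= c by apply: (cvgr_to_ge cc); exact: nearW.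
rewrite -(cvg_shiftn N).
have af n : gadm (c_ n) F by exact: gadm_le aF.
have iC := integrable_corners x aF.
apply: fine_cvg; rewrite fineK; last first.
  apply: integrable_fin_num => //; exact: (gadm_le c0c aF).2.
apply: (@dominated_cvg _ _ _ _ _ measurableT _ _
   (EFin \o (fun y => `|corners c0 x y * F y|))) => //=.
- by move=> n; have /measurable_int := (af (n + N)%N).2 (x_ (n + N)%N).
- move=> y _; apply: cvg_EFin; first exact: nearW.
  apply: cvgM; last exact: cvg_cst.
  by apply: (cvg_gauss (c_ := fun n => c_ (n + N)%N) (x_ := fun n => x_ (n + N)%N)); rewrite cvg_shiftn.
- exact: integrable_norm.
- move=> n y _; rewrite lee_fin normrM [leRHS]normrM ler_wpM2r// (ger0_norm (gauss_ge0 _ _ _)).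
  rewrite (le_trans _ (ler_norm _))// (le_trans (le_gauss _ _ (cc0 _)))//.
  by apply: gauss_le_corners => //; apply: xN; rewrite /= leq_addl.
Qed.

End gauss_weight.

(** Reduces a directional derivative to a derivative in one real variable, where the chain rule and
    [exp_family_derive] apply. *)
Lemma is_derive_line (R : realType) (V : normedModType R) (f : V -> R) (x v : V) (l : R) :
  is_derive (0 : R) (1 : R) (fun h => f (x + h *: v)) l <-> is_derive x v f l.
Proof.
have E : (fun h => h^-1 *: (((fun h => f (x + h *: v)) \o shift 0) (h *: 1) - f (x + 0 *: v)))
       = (fun h : R => h^-1 *: ((f \o shift x) (h *: v) - f x)).
  apply/funext => h; rewrite /= /shift /= addr0 scale0r addr0.
  by rewrite /GRing.scale/= mulr1 [in LHS]addrC [in RHS]addrC (addrC x).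
split=> -[d1 d2]; split.
- by rewrite /derivable -E.
- by rewrite /derive -E.
- by rewrite /derivable E.
- by rewrite /derive E.
Qed.

(** * Derivatives of Gaussian integrals in the centre and in the rate *)

Section gint_derivatives.
Context (R : realType) (d : nat).
Local Notation rV := 'rV[R]_d.
Local Notation leb := (lebesgue_rV R d).
Implicit Types (x y : rV) (F : rV -> R) (c : R).

Definition mom (i : 'I_d) F (y : rV) : R := y ord0 i * F y.

Lemma sqdist_unit x y i (s : R) :
  sqdist (x + s *: unit_rV R i) y =
  sqdist x y + 2 * s * (x ord0 i - y ord0 i) + s ^+ 2.
Proof.
rewrite /sqdist (bigD1 i)//= [in RHS](bigD1 i)//= !mxE !eqxx/= mulr1.
rewrite (eq_bigr (fun j => (x ord0 j - y ord0 j) ^+ 2)); first by ring.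
by move=> j ji; rewrite !mxE (negbTE ji) andbF mulr0 addr0.
Qed.

Lemma gauss_unit c x y i (s : R) :
  gauss c (x + s *: unit_rV R i) y =
  expR (- (c * s ^+ 2)) * (expR (s * (2 * c * (y ord0 i - x ord0 i))) * gauss c x y).
Proof. by rewrite /gauss sqdist_unit -!expRD; congr expR; ring. Qed.

(** By completing the square, the tilted integrand is a constant times the Gaussian integrand about
    a shifted centre, at the same rate. Admissibility at all centres is used here. *)
Lemma integrable_line c F x i (s : R) : gadm c F ->
  leb.-integrable setT (EFin \o (fun y =>
    expR (s * (2 * c * (y ord0 i - x ord0 i))) * (gauss c x y * F y))).
Proof.
move=> aF; rewrite (_ : _ \o _ = (fun y => (expR (c * s ^+ 2))%:E *
    (gauss c (x + s *: unit_rV R i) y * F y)%:E)%E).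
  by apply: integrableZl => //; exact: aF.2.
apply/funext => y; rewrite /= -EFinM gauss_unit; congr EFin.
by rewrite -!mulrA (mulrA (expR (c * _)) (expR _)) -expRD subrr expR0 mul1r.
Qed.

Lemma measurable_mom i F : measurable_fun setT F -> measurable_fun setT (mom i F).
Proof. by move=> mF; apply: measurable_funM => //; exact: measurable_rV_coord. Qed.

Lemma gint_lin c x i F : 0 < c -> gadm c F ->
  is_derive x (unit_rV R i) (fun x => gint c x F)
    (\int[leb]_y (2 * c * (y ord0 i - x ord0 i) * (gauss c x y * F y))) /\
  leb.-integrable setT (EFin \o (fun y =>
    2 * c * (y ord0 i - x ord0 i) * (gauss c x y * F y))).
Proof.
move=> c0 aF.
pose m y := 2 * c * (y ord0 i - x ord0 i).
have mm : measurable_fun setT m.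
  apply: measurable_funM => //; apply: measurable_funB => //.
  exact: measurable_rV_coord.
pose G y := gauss c x y * F y.
(* Any interval around 0 would do, since every tilt is integrable. *)
have iG (s : R) : -1 < s < 1 -> leb.-integrable setT (EFin \o (fun y => expR (s * m y) * G y)).
  by move=> _; exact: integrable_line.
have s0 : (-1 : R) < 0 < (1 : R) by rewrite ltrN10 ltr01.
split; last first.
  have := exp_family_integrable mm iG s0; apply: eq_integrable => // y _.
  by rewrite /= mul0r expR0 mul1r.
apply/is_derive_line.
have E h : gint c (x + h *: unit_rV R i) F =
    expR (- (c * h ^+ 2)) * \int[leb]_y (expR (h * m y) * G y).
  rewrite /gint -RintegralZl//; last exact: integrable_line.
  by apply: eq_Rintegral => y _; rewrite gauss_unit /m /G; ring.
(* The factor exp(-c h^2) has value 1 and derivative 0 at h = 0, so only the exponential family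
   contributes. *)
rewrite (_ : (fun h => _) = (fun h => expR (- (c * h ^+ 2))) *
   (fun h => \int[leb]_y (expR (h * m y) * G y))); last exact/funext/E.
have D := exp_family_derive iG s0.
apply: is_derive_eq.
rewrite /GRing.scale/= expr0n/= !(mulr0, mul0r, oppr0, expR0, scaler0, addr0, mul1r).
by apply: eq_Rintegral => y _; rewrite mul0r expR0 mul1r.
Qed.

(** Up to the factor 2c, the derivative in [gint_lin] integrates (y_i - x_i) F; adding x_i F gives
    y_i F, with no loss in the rate. Iterating yields the second moments. *)
Lemma gadm_mom c F i : 0 < c -> gadm c F -> gadm c (mom i F).
Proof.
move=> c0 aF; split=> [|x]; first by apply: measurable_mom; exact: aF.1.
have [_ iD] := gint_lin x i c0 aF.
rewrite (_ : _ \o _ = (fun y => ((2 * c)^-1)%:E *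
  (2 * c * (y ord0 i - x ord0 i) * (gauss c x y * F y))%:E +
  (x ord0 i)%:E * (gauss c x y * F y)%:E)%E).
  apply: integrableD => //; apply: integrableZl => //; exact: aF.2.
apply/funext => y; rewrite /= -!EFinM -EFinD /mom; congr EFin.
by field; rewrite gt_eqF.
Qed.

Lemma gint_mom_lin c F i x (a b : R) : 0 < c -> gadm c F ->
  \int[leb]_y ((a * y ord0 i + b) * (gauss c x y * F y)) =
  a * gint c x (mom i F) + b * gint c x F.
Proof.
move=> c0 aF; rewrite /gint -!RintegralZl//; last 2 first.
  exact: aF.2.
  exact: (gadm_mom i c0 aF).2.
rewrite -RintegralD//.
- by apply: eq_Rintegral => y _; rewrite /mom; ring.
- rewrite (_ : _ \o _ = (fun y => a%:E * (gauss c x y * mom i F y)%:E)%E)//.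
  by apply: integrableZl => //; exact: (gadm_mom i c0 aF).2.
- rewrite (_ : _ \o _ = (fun y => b%:E * (gauss c x y * F y)%:E)%E)//.
  by apply: integrableZl => //; exact: aF.2.
Qed.

Lemma is_derive_gint_x c F x i : 0 < c -> gadm c F ->
  is_derive x (unit_rV R i) (fun x => gint c x F)
    (2 * c * (gint c x (mom i F) - x ord0 i * gint c x F)).
Proof.
move=> c0 aF; have [D _] := gint_lin x i c0 aF; apply: is_derive_eq.
rewrite mulrBr mulrA -mulNr -(gint_mom_lin _ _ (2 * c) (- (2 * c * x ord0 i)))//.
by apply: eq_Rintegral => y _; congr (_ * _); ring.
Qed.

(** The Gaussian integral of the squared distance times F, expanded into moments so that it is a
    combination of [gint]s, whose joint continuity is known. *)
Definition gsq c x F : R := \sum_i (gint c x (mom i (mom i F)) -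
   2 * x ord0 i * gint c x (mom i F) + x ord0 i ^+ 2 * gint c x F).

Lemma is_derive_gint_c c0 c F x : 0 < c0 < c -> gadm c0 F ->
  is_derive c (1 : R) (fun c => gint c x F) (- gsq c x F).
Proof.
move=> /andP[c00 c0c] aF.
have aFc : gadm c F by apply: gadm_le aF; exact: ltW.
have cp : 0 < c by exact: lt_trans c0c.
(* The family is taken in s = -c, with m the squared distance. The right end -c0 is dictated by
   admissibility, whence the strict inequality between [c0] and [c]; the left end is arbitrary. *)
have iF (s : R) : - (c + 1) < s < - c0 ->
    leb.-integrable setT (EFin \o (fun y => expR (s * sqdist x y) * F y)).
  move=> /andP[_ sc0]; have : gadm (- s) F by apply: gadm_le aF; rewrite lerNr ltW.
  by move=> [_ /(_ x)]; rewrite /gauss; under eq_fun do rewrite mulNr opprK.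
have sc : - (c + 1) < - c < - c0 by rewrite !ltrN2 c0c ltrDl ltr01.
have D := exp_family_derive iF sc.
have Dc : is_derive c (1 : R) (-%R : R -> R) (-1) by exact: is_deriveNid.
have := is_derive1_comp D Dc.
rewrite (_ : _ \o _ = fun c => gint c x F); last first.
  by apply/funext => s; rewrite /= /gint /gauss; apply: eq_Rintegral => y _; rewrite mulNr.
move=> {}D; apply: is_derive_eq; rewrite mulrN1; congr (- _).
rewrite /gsq.
pose H i y := gauss c x y * mom i (mom i F) y - 2 * x ord0 i * (gauss c x y * mom i F y) +
  x ord0 i ^+ 2 * (gauss c x y * F y).
have aM i := gadm_mom i cp aFc.
have aMM i := gadm_mom i cp (aM i).
have iH2 i : leb.-integrable setT (EFin \o (fun y => 2 * x ord0 i * (gauss c x y * mom i F y))).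
  rewrite (_ : _ \o _ = (fun y => (2 * x ord0 i)%:E * (gauss c x y * mom i F y)%:E)%E)//.
  by apply: integrableZl => //; exact: (aM i).2.
have iH3 i : leb.-integrable setT (EFin \o (fun y => x ord0 i ^+ 2 * (gauss c x y * F y))).
  rewrite (_ : _ \o _ = (fun y => (x ord0 i ^+ 2)%:E * (gauss c x y * F y)%:E)%E)//.
  by apply: integrableZl => //; exact: aFc.2.
have iH12 i : leb.-integrable setT (EFin \o (fun y =>
    gauss c x y * mom i (mom i F) y - 2 * x ord0 i * (gauss c x y * mom i F y))).
  rewrite (_ : _ \o _ = (fun y => (gauss c x y * mom i (mom i F) y)%:E -
     (2 * x ord0 i * (gauss c x y * mom i F y))%:E)%E)//.
  exact: (integrableB measurableT ((aMM i).2 x) (iH2 i)).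
have iH i : leb.-integrable setT (EFin \o H i).
  rewrite (_ : _ \o _ = (fun y => (gauss c x y * mom i (mom i F) y -
     2 * x ord0 i * (gauss c x y * mom i F y))%:E + (x ord0 i ^+ 2 * (gauss c x y * F y))%:E)%E)//.
  exact: (integrableD measurableT (iH12 i) (iH3 i)).
transitivity (\sum_i \int[leb]_y H i y); last first.
  apply: eq_bigr => i _; rewrite (RintegralD measurableT (iH12 i) (iH3 i)).
  rewrite (RintegralB measurableT ((aMM i).2 x) (iH2 i)).
  by rewrite (RintegralZl _ measurableT (aFc.2 x)) (RintegralZl _ measurableT ((aM i).2 x)).
transitivity (\int[leb]_y \sum_i H i y).
  apply: eq_Rintegral => y _; rewrite /gauss mulNr /sqdist mulr_suml.
  by apply: eq_bigr => i _; rewrite /H /gauss /mom /sqdist; ring.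
rewrite /Rintegral; under eq_integral do rewrite -sumEFin.
rewrite (integral_sum measurableT iH).
rewrite (eq_bigr (fun i => (fine (\int[leb]_y (H i y)%:E))%:E)); last first.
  by move=> i _; rewrite fineK//; apply: integrable_fin_num => //; exact: iH.
by rewrite sumEFin.
Qed.

End gint_derivatives.

(** * Functions of class C^{1,2} *)

Section C12.
Context (R : realType) (d : nat) (T : R).
Local Notation rV := 'rV[R]_d.
Implicit Types (u v : R -> rV -> R).

(* The closing disjunction lists the functions whose joint continuity is_C12
   requires. *)
Definition C12_with u (ut : R -> rV -> R) (ux : 'I_d -> R -> rV -> R)
    (uxx : 'I_d -> 'I_d -> R -> rV -> R) : Prop :=
  forall (t : R) (x : rV), 0 < t < T ->
  [/\ is_derive t (1 : R) (u ^~ x) (ut t x),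
      forall i, is_derive x (unit_rV R i) (u t) (ux i t x),
      forall i j, is_derive x (unit_rV R j) (ux i t) (uxx i j t x) &
      forall w, [\/ w = u, w = ut, exists i, w = ux i | exists i j, w = uxx i j] ->
        {for (t, x), continuous (fun p : R * rV => w p.1 p.2)}].

Lemma near_time (t : R) (x : rV) : 0 < t < T ->
  \forall p \near (t, x), 0 < p.1 < T.
Proof.
move=> /andP[t0 tT].
have h : \forall s \near t, 0 < s < T.
  near=> s; apply/andP; split; near: s; [exact: lt_nbhsr|exact: lt_nbhsl].
exact: (cvg_fst h).
Unshelve. all: by end_near. Qed.

Lemma grad_is_derive (f : rV -> R) (x : rV) i l :
  is_derive x (unit_rV R i) f l -> grad f x ord0 i = l.
Proof. by move=> fl; rewrite mxE; exact: derive_val. Qed.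

Lemma near_continuous_for (f g : R * rV -> R) (p : R * rV) :
  (\forall q \near p, f q = g q) -> {for p, continuous g} -> {for p, continuous f}.
Proof.
move=> fg cg; rewrite /prop_for /continuous_at (nbhs_singleton fg).
by apply: cvg_trans cg; apply: near_eq_cvg; apply: filterS fg => q ->.
Qed.

(** The actual derivatives agree with the supplied functions at times in ]0, T[, which form a
    neighbourhood of each point considered; continuity carries over by local equality. *)
Lemma C12_withP u ut ux uxx : C12_with u ut ux uxx -> is_C12 T u.
Proof.
move=> H t x t0T; have [D1 D2 D3 C] := H t x t0T.
have gradE : \forall p \near (t, x), forall y i, grad (u p.1) y ord0 i = ux i p.1 y.
  apply: filterS (near_time x t0T) => p p0T y i; apply: grad_is_derive.
  by have [_ h _ _] := H _ y p0T; exact: h.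
split.
- split; [exact: ex_derive|by move=> i; have h := D2 i; exact: ex_derive|move=> i j].
  rewrite (_ : (fun y => _) = ux i t); first by have h := D3 i j; exact: ex_derive.
  by apply/funext => y; exact: (nbhs_singleton gradE).
- by apply: C; constructor 1.
- apply: near_continuous_for (C ut _); last by constructor 2.
  apply: filterS (near_time x t0T) => p p0T; rewrite derive1E.
  by have [h _ _ _] := H _ p.2 p0T; exact: derive_val.
- move=> i; apply: near_continuous_for (C (ux i) _); last by constructor 3; exists i.
  by apply: filterS gradE.
- move=> i j; apply: near_continuous_for (C (uxx i j) _); last by constructor 4; exists i, j.
  near=> p.
  have gE : forall y, grad (u p.1) y ord0 i = ux i p.1 y.
    by near: p; apply: filterS gradE => p h y; exact: h.
  rewrite (_ : (fun y => _) = ux i p.1); last exact/funext/gE.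
  have p0T : 0 < p.1 < T by near: p; exact: near_time.
  by have [_ _ h _] := H _ p.2 p0T; have := h i j => {}h; exact: derive_val.
Unshelve. all: by end_near. Qed.

Section values.
Variables (u ut : R -> rV -> R) (ux : 'I_d -> R -> rV -> R)
  (uxx : 'I_d -> 'I_d -> R -> rV -> R).
Hypothesis uC : C12_with u ut ux uxx.
Variable t : R.
Hypothesis t0T : 0 < t < T.

Lemma C12_with_derive1 x : derive1 (fun s => u s x) t = ut t x.
Proof. by rewrite derive1E; have [h _ _ _] := uC x t0T; exact: derive_val. Qed.

Lemma C12_with_grad x i : grad (u t) x ord0 i = ux i t x.
Proof. by apply: grad_is_derive; have [_ h _ _] := uC x t0T. Qed.

Lemma C12_with_laplacian x : laplacian (u t) x = \sum_i uxx i i t x.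
Proof.
apply: eq_bigr => i _; rewrite (_ : (fun y => _) = ux i t).
  by have [_ _ h _] := uC x t0T; have := h i i => {}h; exact: derive_val.
by apply/funext => y; exact: C12_with_grad.
Qed.
End values.

Lemma C12_with_mul u ut ux uxx v vt vx vxx :
  C12_with u ut ux uxx -> C12_with v vt vx vxx ->
  C12_with (fun t x => u t x * v t x)
    (fun t x => u t x * vt t x + v t x * ut t x)
    (fun i t x => u t x * vx i t x + v t x * ux i t x)
    (fun i j t x => (u t x * vxx i j t x + vx i t x * ux j t x) +
                    (v t x * uxx i j t x + ux i t x * vx j t x)).
Proof.
move=> Hu Hv t x t0T.
have [u1 u2 u3 uc] := Hu t x t0T; have [v1 v2 v3 vc] := Hv t x t0T.
have c0 := uc u (Or41 _ _ _ erefl). have c1 := uc ut (Or42 _ _ _ erefl).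
have c2 i := uc (ux i) (Or43 _ _ _ (ex_intro _ i erefl)).
have c3 i j := uc (uxx i j) (Or44 _ _ _ (ex_intro _ i (ex_intro _ j erefl))).
have e0 := vc v (Or41 _ _ _ erefl). have e1 := vc vt (Or42 _ _ _ erefl).
have e2 i := vc (vx i) (Or43 _ _ _ (ex_intro _ i erefl)).
have e3 i j := vc (vxx i j) (Or44 _ _ _ (ex_intro _ i (ex_intro _ j erefl))).
split.
- exact: is_deriveM.
- by move=> i; exact: is_deriveM.
- by move=> i j; apply: is_deriveD; exact: is_deriveM.
- move=> w [->|->|[i ->]|[i [j ->]]] /=.
  + exact: continuousM.
  + by apply: continuousD; exact: continuousM.
  + by apply: continuousD; exact: continuousM.
  + by apply: continuousD; apply: continuousD; exact: continuousM.
Qed.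

Lemma C12_with_ln (k : R) u ut ux uxx :
  (forall t x, 0 < t < T -> 0 < u t x) -> C12_with u ut ux uxx ->
  C12_with (fun t x => k * ln (u t x)) (fun t x => k * ((u t x)^-1 * ut t x))
    (fun i t x => k * ((u t x)^-1 * ux i t x))
    (fun i j t x => k * ((u t x)^-1 * uxx i j t x -
        (u t x)^-1 ^+ 2 * ux i t x * ux j t x)).
Proof.
move=> u0 Hu t x t0T.
have [u1 u2 u3 uc] := Hu t x t0T.
have c0 := uc u (Or41 _ _ _ erefl). have c1 := uc ut (Or42 _ _ _ erefl).
have c2 i := uc (ux i) (Or43 _ _ _ (ex_intro _ i erefl)).
have c3 i j := uc (uxx i j) (Or44 _ _ _ (ex_intro _ i (ex_intro _ j erefl))).
have utx := u0 _ x t0T.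
have un0 : u t x != 0 by rewrite gt_eqF.
have cV : {for (t, x), continuous (fun p : R * rV => (u p.1 p.2)^-1)}.
  exact: continuousV.
have dln (f : R -> R) s l : 0 < f s -> is_derive s (1 : R) f l ->
    is_derive s (1 : R) (fun r => k * ln (f r)) (k * ((f s)^-1 * l)).
  move=> fs fl.
  by apply: is_deriveZ; apply: (is_derive1_comp (is_derive1_ln fs) fl).
split.
- exact: (dln (u ^~ x)).
- move=> i; apply/is_derive_line.
  have := u2 i => /is_derive_line h.
  have := dln (fun h => u t (x + h *: unit_rV R i)) 0 (ux i t x).
  by rewrite scale0r addr0; exact.
- move=> i j; apply: is_deriveZ.
  have := u3 i j; have := u2 j => h2 h3.
  have hV : is_derive x (unit_rV R j) (fun y => (u t y)^-1) (- (u t x) ^- 2 *: ux j t x).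
    apply/is_derive_line; move/is_derive_line: h2 => h2.
    have := @is_deriveV _ (fun h => u t (x + h *: unit_rV R j)) 0 (ux j t x) 1.
    by rewrite scale0r addr0; exact.
  apply: is_derive_eq (is_deriveM hV h3) _.
  by rewrite /GRing.scale/= exprVn; ring.
- move=> w [->|->|[i ->]|[i [j ->]]] /=.
  + apply: continuousM; first exact: cst_continuous.
    by apply: (continuous_comp c0); exact: continuous_ln.
  + by apply: continuousM; [exact: cst_continuous|exact: continuousM].
  + by apply: continuousM; [exact: cst_continuous|exact: continuousM].
  + apply: continuousM; first exact: cst_continuous.
    apply: continuousB; first exact: continuousM.
    apply: continuousM => //; apply: continuousM => //; apply: continuousM => //.
Qed.

Lemma C12_with_rev u ut ux uxx : C12_with u ut ux uxx ->
  C12_with (fun t => u (T - t)) (fun t x => - ut (T - t) x)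
    (fun i t => ux i (T - t)) (fun i j t => uxx i j (T - t)).
Proof.
move=> Hu t x t0T.
have t0T' : 0 < T - t < T by lra.
have [u1 u2 u3 uc] := Hu (T - t) x t0T'.
have crev (w : R -> rV -> R) : {for (T - t, x), continuous (fun p : R * rV => w p.1 p.2)} ->
    {for (t, x), continuous (fun p : R * rV => w (T - p.1) p.2)}.
  move=> cw; apply: (@continuous_comp _ _ _ (fun p : R * rV => (T - p.1, p.2))
    (fun p : R * rV => w p.1 p.2)); last exact: cw.
  rewrite /prop_for /continuous_at/=.
  apply: (@cvg_pair _ _ _ _ (nbhs (T - t)) (nbhs x) _ _ _ (fun p => T - p.1) snd);
    last exact: cvg_snd.
  by apply: cvgB; [exact: cvg_cst|exact: cvg_fst].
split => //.
- have h : is_derive t (1 : R) (fun s => T - s) (-1).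
    by apply: is_derive_eq; rewrite add0r mul1r.
  by have := is_derive1_comp (f := u ^~ x) (g := fun s => T - s) u1 h; rewrite mulrN1.
- move=> w [->|->|[i ->]|[i [j ->]]] /=; last 2 first.
  + by apply: crev; apply: uc; constructor 3; exists i.
  + by apply: crev; apply: uc; constructor 4; exists i, j.
  + by apply: crev; apply: uc; constructor 1.
  + by apply: continuousN; apply: crev; apply: uc; constructor 2.
Qed.

End C12.

(** * Heat equation *)

Section heat_evolution.
Context (R : realType) (d : nat) (beta : R).
Hypothesis beta0 : 0 < beta.
Local Notation rV := 'rV[R]_d.
Local Notation leb := (lebesgue_rV R d).
Implicit Types (x y : rV) (F : rV -> R) (t : R).

(** Decreasing in t, so that by [gadm_le] admissibility at the final time gives admissibility at all
    earlier ones. *)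
Definition rate t : R := (4 * beta * t)^-1.
Definition peak t : R := (Num.sqrt ((4 * pi * beta * t) ^+ d))^-1.

Lemma rate_gt0 t : 0 < t -> 0 < rate t.
Proof. by move=> t0; rewrite invr_gt0 !mulr_gt0. Qed.

Lemma lt_rate t t' : 0 < t < t' -> rate t' < rate t.
Proof.
move=> /andP[t0 tt']; have t'0 := lt_trans t0 tt'.
by rewrite ltf_pV2 ?posrE ?mulr_gt0// ltr_pM2l// mulr_gt0.
Qed.

Lemma le_rate t t' : 0 < t <= t' -> rate t' <= rate t.
Proof.
move=> /andP[t0 tt']; have t'0 := lt_le_trans t0 tt'.
by rewrite lef_pV2 ?posrE ?mulr_gt0// ler_pM2l// mulr_gt0.
Qed.

Lemma peak_gt0 t : 0 < t -> 0 < peak t.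
Proof. by move=> t0; rewrite invr_gt0 sqrtr_gt0 exprn_gt0// !mulr_gt0// pi_gt0. Qed.

Lemma heat_kernelE t x y : heat_kernel beta t x y = peak t * gauss (rate t) x y.
Proof. by rewrite /heat_kernel enorm_sqdist mulrC mulrC (mulrC (sqdist x y)). Qed.

Lemma heat_convE t F x : t != 0 -> gadm (rate t) F ->
  heat_conv beta t F x = peak t * gint (rate t) x F.
Proof.
move=> t0 aF; rewrite /heat_conv (negbTE t0) -RintegralZl//; last exact: aF.2.
by apply: eq_Rintegral => y _; rewrite heat_kernelE mulrA.
Qed.

Lemma heat_conv_integrableP t F x : gadm (rate t) F -> heat_conv_integrable beta t F x.
Proof.
move=> aF t0; rewrite (_ : _ \o _ = (fun y => (peak t)%:E * (gauss (rate t) x y * F y)%:E)%E).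
  by apply: integrableZl => //; exact: aF.2.
by apply/funext => y; rewrite /= heat_kernelE -mulrA.
Qed.

Lemma is_derive_rate t : 0 < t -> is_derive t (1 : R) rate (- (rate t / t)).
Proof.
move=> t0; have b0 : 4 * beta != 0 :> R by rewrite gt_eqF// mulr_gt0.
have n0 : 4 * beta * t != 0 by rewrite mulf_neq0// gt_eqF.
rewrite /rate.
have D : is_derive t (1 : R) (fun s => 4 * beta * s) (4 * beta).
  by apply: is_derive_eq; rewrite /GRing.scale/= mulr1.
apply: (is_derive_eq (is_deriveV (f := fun s => 4 * beta * s) n0 D)).
by rewrite /GRing.scale/=; field; rewrite !gt_eqF.
Qed.

Lemma is_derive_peak t : 0 < t -> is_derive t (1 : R) peak (- (d%:R / (2 * t)) * peak t).
Proof.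
move=> t0; set a := 4 * pi * beta.
have a0 : 0 < a by rewrite !mulr_gt0// pi_gt0.
have at0 : 0 < (a * t) ^+ d by rewrite exprn_gt0// mulr_gt0.
have D : is_derive t (1 : R) (fun s => (a * s) ^+ d) (d%:R * (a * t) ^+ d / t).
  have D1 : is_derive t (1 : R) (fun s => a * s) a.
    by apply: is_derive_eq; rewrite /GRing.scale/= mulr1.
  rewrite (_ : (fun s => _) = (fun s => a * s) ^+ d); last first.
    by apply/funext => s; rewrite exprfctE.
  apply: (is_derive_eq (is_deriveX d D1)).
  rewrite /GRing.scale/=; case: (d) => [|n]; first by rewrite !mul0r.
  by rewrite exprS; field; rewrite gt_eqF.
have D2 := is_derive1_comp (f := Num.sqrt) (g := fun s => (a * s) ^+ d) (is_derive1_sqrt at0) D.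
have n0 : (Num.sqrt \o (fun s => (a * s) ^+ d)) t != 0 by rewrite /= gt_eqF// sqrtr_gt0.
apply: (is_derive_eq (is_deriveV n0 D2)).
rewrite /GRing.scale/= /peak -/a.
(* The power (a t)^d is written as the square of its square root, so that [field] can cancel it
   against the root in [peak]. *)
rewrite -[X in d%:R * X / t](sqr_sqrtr (ltW at0)).
by field; rewrite !gt_eqF ?sqrtr_gt0.
Qed.

Lemma continuous_rate t : 0 < t -> {for t, continuous rate}.
Proof.
move=> t0; have h := is_derive_rate t0.
by apply/differentiable_continuous/derivable1_diffP; exact: ex_derive.
Qed.

Lemma continuous_peak t : 0 < t -> {for t, continuous peak}.
Proof.
move=> t0; have h := is_derive_peak t0.
by apply/differentiable_continuous/derivable1_diffP; exact: ex_derive.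
Qed.

Variables (T : R) (F : rV -> R).
Hypothesis T0 : 0 < T.
Hypothesis aF : gadm (rate T) F.

Let G t x := gint (rate t) x F.
Let G1 i t x := gint (rate t) x (mom i F).
Let G2 i j t x := gint (rate t) x (mom i (mom j F)).

(** Product rule: the derivative of [rate] is - rate / t, that of [gint] in the rate is - [gsq], and
    that of [peak] is - d / (2 t) times [peak]. *)
Definition heat_t t x : R :=
  peak t * (rate t / t * gsq (rate t) x F) - d%:R / (2 * t) * (peak t * G t x).
Definition heat_x i t x : R := peak t * (2 * rate t * (G1 i t x - x ord0 i * G t x)).
(** The derivative of [heat_x] in direction j; the term with [i == j] comes from differentiating
    x_i. *)
Definition heat_xx i j t x : R := peak t * (2 * rate t *
  (2 * rate t * (G2 j i t x - x ord0 j * G1 i t x) -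
   (x ord0 i * (2 * rate t * (G1 j t x - x ord0 j * G t x)) + (i == j)%:R * G t x))).

(** The Laplacian is peak * 2 rate * (2 rate * gsq - d G). It matches the time derivative through
    rate / t = 4 beta rate^2 and d / (2 t) = 2 beta rate d. *)
Lemma heat_equation t x : 0 < t ->
  heat_t t x = beta * \sum_i heat_xx i i t x.
Proof.
move=> t0; rewrite (eq_bigr (fun i => peak t * (2 * rate t *
  (2 * rate t * (G2 i i t x - 2 * x ord0 i * G1 i t x + x ord0 i ^+ 2 * G t x)
   - G t x)))); last by move=> i _; rewrite /heat_xx eqxx mul1r; ring.
rewrite -mulr_sumr -mulr_sumr.
rewrite sumrB -mulr_sumr sumr_const card_ord -[_ *+ d]mulr_natl /heat_t /gsq.
set S := \sum_i _;
have -> : rate t / t = 4 * beta * rate t ^+ 2.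
  by rewrite /rate; field; rewrite !gt_eqF.
have -> : d%:R / (2 * t) = 2 * beta * rate t * d%:R.
  by rewrite /rate; field; rewrite !gt_eqF.
by ring.
Qed.

Lemma cvg_rV_heat (A : set (R * rV)) (H : rV -> R) t x : gadm (rate T) H ->
  0 < t -> A `<=` [set p | 0 < p.1 <= T] ->
  gint (rate p.1) p.2 H @[p --> within A (nbhs (t, x))] --> gint (rate t) x H.
Proof.
move=> aH t0 AT; apply: cvg_within_seq => u Au ut.
have u1 : (u n).1 @[n --> \oo] --> t by apply: (cvg_comp _ _ ut); exact: cvg_fst.
have u2 : (u n).2 @[n --> \oo] --> x by apply: (cvg_comp _ _ ut); exact: cvg_snd.
apply: (@cvg_gint _ _ (rate T) H (fun n => rate (u n).1) (fun n => (u n).2)) => //.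
- exact/ltW/rate_gt0.
- by move=> n; apply: le_rate; exact: (AT _ (Au n)).
- by apply: (cvg_comp _ _ u1); exact: continuous_rate.
Qed.

Lemma continuous_gint_heat (H : rV -> R) t x : gadm (rate T) H -> 0 < t < T ->
  {for (t, x), continuous (fun p : R * rV => gint (rate p.1) p.2 H)}.
Proof.
move=> aH t0T; have /andP[t0 _] := t0T.
have h := @cvg_rV_heat [set p | 0 < p.1 < T] H t x aH t0.
rewrite /prop_for /continuous_at/=; apply: cvg_trans (h _); last first.
  by move=> p /= /andP[-> /ltW ->].
move=> U WU.
have {}WU : \forall p \near (t, x), 0 < p.1 < T -> U (gint (rate p.1) p.2 H) by [].
change (\forall p \near (t, x), U (gint (rate p.1) p.2 H)).
near=> p.
have p0T : 0 < p.1 < T by near: p; exact: near_time.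
by move: p0T; near: p.
Unshelve. all: by end_near. Qed.

Lemma is_derive_coord x i j :
  is_derive x (unit_rV R j) (fun x => x ord0 i) ((i == j)%:R : R).
Proof.
apply/is_derive_line.
rewrite (_ : (fun h => _) = (fun h => x ord0 i + h * (i == j)%:R)); last first.
  by apply/funext => h; rewrite !mxE eqxx eq_sym.
by apply: is_derive_eq; rewrite /GRing.scale/= add0r mul1r mulr0 add0r mulr1.
Qed.

Lemma heat_C12 :
  C12_with T (fun t x => peak t * G t x) heat_t heat_x heat_xx.
Proof.
move=> t x t0T; have /andP[t0 tT] := t0T.
have r0 := rate_gt0 t0.
have rT := rate_gt0 T0.
have aFt : gadm (rate t) F by apply: gadm_le aF; apply/ltW/lt_rate.
have aM i := gadm_mom i rT aF.
have aMt i := gadm_mom i r0 aFt.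
split.
- have D : is_derive t (1 : R) (fun s => G s x) (- gsq (rate t) x F * - (rate t / t)).
    apply: (is_derive1_comp (f := fun c => gint c x F) (g := rate)).
      by apply: is_derive_gint_c aF; rewrite rT/= lt_rate.
    exact: is_derive_rate.
  have Dp := is_derive_peak t0.
  apply: (is_derive_eq (is_deriveM Dp D)).
  by rewrite /GRing.scale/= /heat_t; ring.
- move=> i; have D := is_derive_gint_x x i r0 aFt.
  exact: (is_deriveZ (peak t) D).
- move=> i j; apply: (is_deriveZ (peak t)); apply: (is_deriveZ (2 * rate t)).
  apply: is_deriveB; first exact: is_derive_gint_x.
  apply: (is_derive_eq (is_deriveM (is_derive_coord x i j) (is_derive_gint_x x j r0 aFt))).
  by rewrite /GRing.scale/= [X in _ + X = _]mulrC.
- have cf1 : {for (t, x), continuous (fun p : R * rV => p.1)} by exact: cvg_fst.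
  have cr : {for (t, x), continuous (fun p : R * rV => rate p.1)}.
    by apply: (continuous_comp cf1); exact: continuous_rate.
  have cp : {for (t, x), continuous (fun p : R * rV => peak p.1)}.
    by apply: (continuous_comp cf1); exact: continuous_peak.
  have cG : {for (t, x), continuous (fun p : R * rV => G p.1 p.2)}.
    exact: continuous_gint_heat.
  have cG1 i : {for (t, x), continuous (fun p : R * rV => G1 i p.1 p.2)}.
    by apply: continuous_gint_heat.
  have cG2 i j : {for (t, x), continuous (fun p : R * rV => G2 i j p.1 p.2)}.
    by apply: continuous_gint_heat => //; exact: gadm_mom.
  have cx i : {for (t, x), continuous (fun p : R * rV => p.2 ord0 i)}.
    by apply: (@continuous_comp _ _ _ snd (fun x : rV => x ord0 i)); [exact: cvg_snd|exact: coord_continuous].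
  have cc (k : R) : {for (t, x), continuous (fun p : R * rV => k)} by exact: cst_continuous.
  have ct : {for (t, x), continuous (fun p : R * rV => p.1^-1)}.
    by apply: continuousV => //=; rewrite gt_eqF.
  have c2t : {for (t, x), continuous (fun p : R * rV => (2 * p.1)^-1)}.
    by apply: continuousV; [rewrite /= gt_eqF// mulr_gt0|exact: continuousM].
  move=> w [->|->|[i ->]|[i [j ->]]] /=.
  + exact: continuousM.
  + apply: continuousB.
      apply: continuousM => //; apply: continuousM; first exact: continuousM.
      apply: cvg_bigsum => i; apply: cvgD.
        apply: cvgB; first exact: cG2.
        by apply: cvgM; [apply: cvgM; [exact: cvg_cst|exact: cx]|exact: cG1].
      apply: cvgM; last exact: cG.
      by apply: (continuous_cvg _ (@exprn_continuous _ 2 _)); exact: cx.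
    by apply: continuousM; [exact: continuousM|exact: continuousM].
  + apply: continuousM => //; apply: continuousM; first exact: continuousM.
    by apply: continuousB => //; exact: continuousM.
  + apply: continuousM => //; apply: continuousM; first exact: continuousM.
    apply: continuousB.
      apply: continuousM; first exact: continuousM.
      by apply: continuousB => //; exact: continuousM.
    apply: continuousD; last exact: continuousM.
    apply: continuousM => //; apply: continuousM; first exact: continuousM.
    by apply: continuousB => //; exact: continuousM.
Qed.

End heat_evolution.

(** * Heat kernel *)

Section heat_kernel_theory.
Context (R : realType) (d : nat) (beta : R).
Hypothesis beta0 : 0 < beta.
Local Notation rV := 'rV[R]_d.
Local Notation leb := (lebesgue_rV R d).
Local Notation peak := (peak d beta).
Local Notation rate := (rate beta).
Local Notation hk := (@heat_kernel R d beta).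
Implicit Types (x y : rV) (F : rV -> R) (t : R).

Lemma heat_kernel_ge0 t x y : 0 < t -> 0 <= hk t x y.
Proof. by move=> t0; rewrite heat_kernelE mulr_ge0 ?gauss_ge0// ltW// peak_gt0. Qed.

Lemma measurable_heat_kernel t : measurable_fun setT (fun p : rV * rV => hk t p.1 p.2).
Proof.
under eq_fun do rewrite heat_kernelE.
by apply: measurable_funM => //; exact: measurable_gauss.
Qed.

Lemma sqrtrX_nat (a : R) n : 0 <= a -> Num.sqrt (a ^+ n) = Num.sqrt a ^+ n.
Proof.
by move=> a0; elim: n => [|n IH]; rewrite ?expr0 ?sqrtr1// !exprS sqrtrM// IH.
Qed.

Lemma integral_heat_kernel t x : 0 < t -> (\int[leb]_y (hk t x y)%:E = 1)%E.
Proof.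
(* Each coordinate is normal with variance 2 beta t, since 2 s^2 = 4 beta t. *)
move=> t0; pose s := Num.sqrt (2 * beta * t).
have s2 : s ^+ 2 = 2 * beta * t by rewrite sqr_sqrtr// !mulr_ge0 ?ltW.
have s0 : s != 0 by rewrite gt_eqF// sqrtr_gt0 !mulr_gt0.
transitivity (\int[leb]_y (\prod_i normal_pdf (x ord0 i) s (y ord0 i))%:E)%E.
  apply: eq_integral => y _; rewrite heat_kernelE gauss_prod; congr EFin.
  rewrite /peak sqrtrX_nat; last by rewrite !mulr_ge0 ?pi_ge0// ltW.
  rewrite -exprVn.
  have -> : (Num.sqrt (4 * pi * beta * t))^-1 ^+ d =
      \prod_(i < d) (Num.sqrt (4 * pi * beta * t))^-1 by rewrite prodr_const card_ord.
  rewrite -big_split/=; apply: eq_bigr => i _.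
  rewrite normal_pdfE// /normal_peak /normal_fun s2; congr (_ * expR _).
    by congr (Num.sqrt _)^-1; ring.
  by rewrite /rate; field; rewrite !gt_eqF.
rewrite (@integral_prod_rV _ _ (fun i => normal_pdf (x ord0 i) s)).
- by rewrite big1// => i _; exact: integral_normal_pdf.
- by move=> i; exact: measurable_normal_pdf.
- by move=> i y; exact: normal_pdf_ge0.
Qed.

Lemma integrable_heat_kernel t x : 0 < t ->
  leb.-integrable setT (EFin \o hk t x).
Proof.
move=> t0; apply/integrableP; split.
  apply/measurable_EFinP.
  exact: (measurableT_comp (measurable_heat_kernel t) (measurable_pair1 x)).
rewrite (eq_integral (fun y => (hk t x y)%:E)) ?integral_heat_kernel ?ltry//.
by move=> y _; rewrite /= ger0_norm// heat_kernel_ge0.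
Qed.

Lemma gadm_bounded t F : 0 < t -> measurable_fun setT F ->
  (exists M, forall x, `|F x| <= M) -> gadm (rate t) F.
Proof.
move=> t0 mF [M FM]; split => // x.
have mg : measurable_fun setT (gauss (rate t) x) by exact: measurable_gaussr.
have iM := integrableZl measurableT (M / peak t) (integrable_heat_kernel x t0).
apply: (le_integrable measurableT) iM => /=.
  by apply/measurable_EFinP; exact: measurable_funM.
move=> y _; rewrite lee_fin heat_kernelE mulrA divfK ?gt_eqF ?peak_gt0//.
by rewrite normrM [leRHS]normrM mulrC ler_wpM2r// (le_trans (FM y))// ler_norm.
Qed.

Lemma gint_lower_bound c x F : 0 < c -> (forall y, 0 <= F y) -> 0 < F x ->
  {for x, continuous F} -> gadm c F ->
  exists2 C, 0 < C & forall y, C * gauss c x y <= gint c y F.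
Proof.
move=> c0 F0 Fx0 cF aF.
have [r /andP[r0 r1] Fr] : exists2 r, 0 < r <= 1 &
    forall z : rV, (forall i, `|x ord0 i - z ord0 i| <= r) -> F x / 2 <= F z.
  have /nbhs_ballP[e /= e0 eF] : \forall z \near x, F x / 2 < F z.
    by move: cF => /cvgr_gt; apply; lra.
  exists (Num.min 1 (e / 2)); first by rewrite lt_min ge_min ltr01 lexx divr_gt0.
  move=> z xz; apply/ltW/eF/ball_rVE; split => // i.
  by rewrite (le_lt_trans (xz i))// gt_min; apply/orP; right; lra.
(* The three factors are a lower bound of F on the cube, the error in the exponent (c per
   coordinate), and the volume of the cube. *)
exists (F x / 2 * expR (- c) ^+ d * r ^+ d).
  by rewrite !mulr_gt0// exprn_gt0// expR_gt0.
move=> y.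
(* The side of the cube is chosen towards y, so that it brings z closer to y
   up to a bounded error. *)
pose J i : set R := if x ord0 i <= y ord0 i then `[x ord0 i, x ord0 i + r]%classic
  else `[x ord0 i - r, x ord0 i]%classic.
have mJ i : measurable (J i) by rewrite /J; case: ifPn.
have JE i : (\int[lebesgue_measure]_u (\1_(J i) u)%:E = r%:E)%E.
  transitivity (lebesgue_measure (J i)).
    rewrite integral_indic//; last exact: mJ.
    by congr (lebesgue_measure _); exact: setIT.
  rewrite /J; case: ifPn => _; rewrite lebesgue_measure_itv/=.
    by rewrite lte_fin ltrDl r0 -EFinB addrAC subrr add0r.
  by rewrite lte_fin gtrBl r0 -EFinB opprB addrCA subrr addr0.
pose B (z : rV) := \prod_i (\1_(J i) (z ord0 i) : R).
have intB : (\int[leb]_z (B z)%:E = (r ^+ d)%:E)%E.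
  rewrite (@integral_prod_rV _ _ (fun i => \1_(J i))).
  - by rewrite (eq_bigr (fun=> r%:E)) ?prodEFin ?prodr_const ?card_ord.
  - by move=> i; exact: measurable_indic.
  - by move=> i z; rewrite indicE.
have iF := aF.2 y.
rewrite -lee_fin /gint fineK; last by apply: integrable_fin_num.
pose K := F x / 2 * expR (- c) ^+ d * gauss c x y.
have K0 : 0 <= K by rewrite !mulr_ge0 ?exprn_ge0 ?expR_ge0 ?ltW.
have mB : measurable_fun setT (fun z : rV => B z).
  apply: measurable_prod => i _.
  have mI : measurable_fun setT (\1_(J i) : R -> R) by exact: measurable_indic.
  by apply: (measurableT_comp mI); exact: measurable_rV_coord.
have -> : (F x / 2 * expR (- c) ^+ d * r ^+ d * gauss c x y)%:E =
    (\int[leb]_z (K * B z)%:E)%E.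
  under eq_integral do rewrite EFinM.
  rewrite ge0_integralZl// ?intB.
  - by rewrite -EFinM /K; congr EFin; ring.
  - exact/measurable_EFinP.
  - by move=> z _; rewrite lee_fin prodr_ge0// => i _; rewrite indicE.
apply: ge0_le_integral => //=.
- by move=> z _; rewrite lee_fin mulr_ge0// prodr_ge0// => i _; rewrite indicE.
- by apply/measurable_EFinP; exact: measurable_funM.
- by apply/measurable_EFinP; apply: measurable_funM; [exact: measurable_gaussr|exact: aF.1].
move=> z _; rewrite lee_fin.
have [zJ|] := pselect (forall i, J i (z ord0 i)); last first.
  move/existsNP => [i Ji]; rewrite /B (bigD1 i)//= indicE memNset//.
  by rewrite mul0r mulr0 mulr_ge0// gauss_ge0.
(* Here r <= 1 matters: z lies on the same side of x as y, and overshooting y raises the squared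
   distance by at most r^2. *)
have xz i : `|x ord0 i - z ord0 i| <= r /\
    (y ord0 i - z ord0 i) ^+ 2 <= (x ord0 i - y ord0 i) ^+ 2 + 1.
  move: (zJ i); rewrite /J; case: ifPn => xy; rewrite /= in_itv/= => /andP[za zb].
    by split; [rewrite ler_norml; lra|nra].
  by move: xy; rewrite -ltNge => xy; split; [rewrite ler_norml; lra|nra].
rewrite /B big1; last by move=> i _; rewrite indicE mem_set.
rewrite mulr1 /K -mulrA mulrC ler_pM ?mulr_ge0 ?exprn_ge0 ?expR_ge0//.
- rewrite !gauss_prod.
  have -> : expR (- c) ^+ d = \prod_(i < d) expR (- c) by rewrite prodr_const card_ord.
  rewrite -big_split/=; apply: ler_prod => i _; rewrite -expRD expR_ge0 ler_expR/=.
  by have := ler_wpM2l (ltW c0) (xz i).2; lra.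
- by apply: Fr => i; exact: (xz i).1.
Qed.

End heat_kernel_theory.

(** * Convergence to the initial datum *)

Section approximate_identity.
Context (R : realType) (d : nat) (beta : R).
Hypothesis beta0 : 0 < beta.
Hypothesis d1 : (1 <= d)%N.
Local Notation rV := 'rV[R]_d.
Local Notation leb := (lebesgue_rV R d).
Local Notation peak := (peak d beta).
Local Notation rate := (rate beta).
Local Notation hk := (@heat_kernel R d beta).
Implicit Types (x y : rV) (F : rV -> R) (t : R).

(** exp(-a) is the n-th power of exp(-a/n), and exp(a/n) >= a/n. Taking n = d gives a power of time
    that is the square of 1 / [peak]. *)
Lemma expRN_le_exprV n (a : R) : 0 < a -> expR (- a) <= (n%:R / a) ^+ n.
Proof.
move=> a0; case: n => [|n]; first by rewrite expr0 -expR0 ler_expR; lra.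
have -> : - a = n.+1%:R * - (a / n.+1%:R) by rewrite mulrN [_ * (a / _)]mulrC divfK ?pnatr_eq0.
rewrite expRM_natl; apply: lerXn2r; rewrite ?nnegrE ?expR_ge0 ?divr_ge0 ?(ltW a0)//.
rewrite expRN -[leRHS]invrK lef_pV2 ?posrE ?expR_gt0 ?invr_gt0 ?divr_gt0//.
by rewrite invf_div (le_trans _ (expR_ge1Dx _))// lerDr.
Qed.

(* The exponential decay of the Gaussian tail beats the peak s^(-d/2); for
   d = 0 the limit is 1. *)
Lemma cvg_peak_exp (a : R) : 0 < a ->
  peak s * expR (- (a * rate s)) @[s --> 0^'+] --> (0 : R).
Proof.
move=> a0.
pose b := 4 * pi * beta; have b0 : 0 < b by rewrite !mulr_gt0// pi_gt0.
(* With this [k], (d / (a rate s))^d = k (b s)^d; multiplied by [peak s] it leaves k sqrt((b s)^d),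
   which tends to 0. *)
pose k := (d%:R / (a * pi)) ^+ d.
have lim0 : k * Num.sqrt ((b * s) ^+ d) @[s --> 0^'+] --> (0 : R).
  apply: cvg_at_right_filter.
  rewrite [X in _ --> X](_ : 0 = k * Num.sqrt ((b * 0) ^+ d)); last first.
    by rewrite mulr0 expr0n gtn_eqF// sqrtr0 mulr0.
  apply: cvgM; first exact: cvg_cst.
  apply: (continuous_cvg _ (@sqrt_continuous R _)).
  apply: (continuous_cvg _ (@exprn_continuous R d _)).
  by apply: cvgM; [exact: cvg_cst|exact: cvg_id].
apply: (@squeeze_cvgr _ _ _ _ (cst 0) (fun s => k * Num.sqrt ((b * s) ^+ d))) => //;
  last exact: cvg_cst.
near=> s.
have s0 : 0 < s by near: s; exact: nbhs_right_gt.
have w0 : 0 < (b * s) ^+ d by rewrite exprn_gt0// mulr_gt0.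
rewrite mulr_ge0 ?expR_ge0 ?(ltW (peak_gt0 _ beta0 s0))//=.
rewrite /peak -/b ler_pdivrMl ?sqrtr_gt0// mulrCA -expr2 sqr_sqrtr ?(ltW w0)//.
rewrite (le_trans (expRN_le_exprV d _)) ?mulr_gt0 ?rate_gt0//.
rewrite /k -exprMn le_eqVlt; apply/orP; left; apply/eqP; congr (_ ^+ _).
rewrite /rate /b; move: (@pi_gt0 R); move: pi => p p0.
by field; rewrite !gt_eqF.
Unshelve. all: by end_near. Qed.

(** Near [x] the continuity of [F] suffices. If y is at least r away from [x] in some coordinate, it
    is at least r / 2 away from the moving centre z, and the excess rate bounds gauss (rate s) by
    exp(-(rate s - rate T) r^2 / 4) gauss (rate T). The first factor beats [peak s]; the second is
    integrated with the majorant [corners], uniformly in z. The moving centre is needed for joint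
    continuity and for the bridge mean. *)
Lemma cvg_heat_conv0 T F x : 0 < T -> gadm (rate T) F -> {for x, continuous F} ->
  heat_conv beta p.1 F p.2 @[p --> within [set p | 0 < p.1 <= T] (nbhs ((0 : R), x))]
    --> F x.
Proof.
move=> T0 aF cF; apply: cvg_within_seq => u uT ux.
have u1 : (u n).1 @[n --> \oo] --> (0 : R) by apply: (cvg_comp _ _ ux); exact: cvg_fst.
have u2 : (u n).2 @[n --> \oo] --> x by apply: (cvg_comp _ _ ux); exact: cvg_snd.
have u1r : (u n).1 @[n --> \oo] --> 0^'+.
  move=> A [e /= e0 eA]; have [N _ NP] : \forall n \near \oo, `|(u n).1| < e by exact: (cvgr0_norm_lt _ u1).
  exists N => // n /NP/= ue; apply: eA; last by have /andP[] := uT n.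
  by rewrite /= sub0r normrN.
apply/cvgrPdist_lt => e e0.
have [r r0 Fr] : exists2 r, 0 < r &
    forall y : rV, (forall i, `|x ord0 i - y ord0 i| < r) -> `|F x - F y| < e / 2.
  have /nbhs_ballP[r /= r0 rF] : \forall y \near x, `|F x - F y| < e / 2.
    by move/cvgrPdist_lt: cF => /(_ (e / 2)); apply; rewrite divr_gt0.
  by exists r => // y xy; apply: rF; apply/ball_rVE; split.
have r40 : 0 < r ^+ 2 / 4 by rewrite divr_gt0// exprn_gt0.
pose F1 y := `|F y| + `|F x|.
have aF1 : gadm (rate T) F1.
  have [mF iF] := aF.
  have [mc ic] : gadm (rate T) (fun _ : rV => `|F x|).
    by apply: (gadm_bounded beta0 T0) => //; exists `|F x| => y; rewrite normr_id.
  split=> [|y]; first by apply: measurable_funD => //; exact: measurableT_comp.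
  rewrite (_ : _ \o _ = (fun z => `|(gauss (rate T) y z * F z)%:E| +
      (gauss (rate T) y z * `|F x|)%:E)%E).
    exact: (integrableD measurableT (integrable_abse (iF y)) (ic y)).
  by apply/funext => z; rewrite /= -EFinD mulrDr normrM (ger0_norm (gauss_ge0 _ _ _)).
have iC := integrable_corners x aF1.
pose D := \int[leb]_y (corners (rate T) x y * F1 y).
(* [K] compensates for the share [rate T] of the exponent that is kept for integrability. *)
pose K := expR (rate T * (r ^+ 2 / 4)).
have cvgB : K * (peak (u n).1 * expR (- (r ^+ 2 / 4 * rate (u n).1))) * D
    @[n --> \oo] --> (0 : R).
  rewrite [X in _ --> X](_ : 0 = K * 0 * D); last by rewrite mulr0 mul0r.
  apply: cvgM; last exact: cvg_cst.
  apply: cvgM; first exact: cvg_cst.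
  exact: (cvg_comp _ _ u1r (cvg_peak_exp r40)).
(* The bound 1 puts z in the cube on which [corners] is a majorant; r / 2 keeps z at distance at
   least r / 2 from the far y. *)
have m0 : 0 < Num.min 1 (r / 2) by rewrite lt_min ltr01 divr_gt0.
near=> n.
have xz : forall i, `|x ord0 i - (u n).2 ord0 i| < Num.min 1 (r / 2).
  near: n.
  by move/cvg_ballP: u2 => /(_ _ m0); apply: filterS => n /ball_rVE[].
have B0 : `|K * (peak (u n).1 * expR (- (r ^+ 2 / 4 * rate (u n).1))) * D| < e / 2.
  by near: n; apply: cvgr0_norm_lt => //; rewrite divr_gt0.
have /andP[s0 sT] := uT n.
set s := (u n).1 in s0 sT B0 *; set z := (u n).2 in xz *.
have aFs : gadm (rate s) F by apply: gadm_le aF; apply: le_rate; rewrite ?s0.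
pose B := K * (peak s * expR (- (r ^+ 2 / 4 * rate s))).
have ps := ltW (peak_gt0 d beta0 s0).
have Bge0 : 0 <= B by rewrite mulr_ge0 ?expR_ge0// mulr_ge0 ?expR_ge0.
have pw y : `|hk s z y * (F x - F y)| <=
    e / 2 * hk s z y + B * (corners (rate T) x y * F1 y).
  rewrite normrM ger0_norm ?heat_kernel_ge0//.
  have [xy|] := pselect (forall i, `|x ord0 i - y ord0 i| < r).
    apply: ler_wpDr.
      by rewrite !mulr_ge0 ?addr_ge0 ?exprn_ge0 ?expR_ge0 ?sumr_ge0// => b _; exact: gauss_ge0.
    by rewrite mulrC ler_wpM2r ?heat_kernel_ge0// ltW// Fr.
  move=> /existsNP[i /negP]; rewrite -leNgt => rxy.
  apply: ler_wpDl; first by rewrite mulr_ge0 ?heat_kernel_ge0// ltW// divr_gt0.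
  rewrite mulrA; apply: ler_pM; rewrite ?heat_kernel_ge0//; last first.
    by rewrite /F1 [leRHS]addrC ler_normB.
  have gC : gauss (rate T) z y <= corners (rate T) x y.
    apply: gauss_le_corners; first exact/ltW/rate_gt0.
    by move=> j; apply/ltW/(lt_le_trans (xz j)); rewrite ge_min lexx.
  rewrite heat_kernelE /B /K -!mulrA mulrCA ler_pM2l ?peak_gt0//.
  rewrite [leRHS]mulrA -expRD (le_trans _ (ler_wpM2l (expR_ge0 _) gC))//.
  rewrite -expRD ler_expR.
  have ryz : r / 2 <= `|z ord0 i - y ord0 i|.
    have := xz i; rewrite lt_min => /andP[_ xzi].
    have := ler_distD (z ord0 i) (x ord0 i) (y ord0 i); lra.
  have q : r ^+ 2 / 4 <= sqdist z y.
    rewrite /sqdist (bigD1 i)//= ler_wpDr//.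
      by apply: sumr_ge0 => j _; exact: sqr_ge0.
    rewrite -(real_normK (num_real (z ord0 i - y ord0 i))).
    have -> : r ^+ 2 / 4 = (r / 2) ^+ 2 by field.
    by rewrite lerXn2r ?nnegrE// divr_ge0// ltW.
  have rr : 0 <= rate s - rate T by rewrite subr_ge0 le_rate// s0.
  have := ler_wpM2l rr q; lra.
have ih := integrable_heat_kernel beta0 z s0.
have ihF := heat_conv_integrableP (beta := beta) z aFs (lt0r_neq0 s0).
have ihx : leb.-integrable setT (EFin \o (fun y => F x * hk s z y)).
  rewrite (_ : _ \o _ = (fun y => (F x)%:E * (hk s z y)%:E)%E)//.
  exact: integrableZl.
have hE : F x - heat_conv beta s F z = \int[leb]_y (hk s z y * (F x - F y)).
  rewrite /heat_conv gt_eqF// -[X in X - _](mulr1 (F x)).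
  have <- : \int[leb]_y hk s z y = 1 by rewrite /Rintegral integral_heat_kernel.
  rewrite -RintegralZl// -RintegralB//.
  by apply: eq_Rintegral => y _; ring.
have ihd : leb.-integrable setT (EFin \o (fun y => hk s z y * (F x - F y))).
  rewrite (_ : _ \o _ = (fun y => (F x * hk s z y)%:E - (hk s z y * F y)%:E)%E).
    exact: integrableB.
  by apply/funext => y; rewrite /= -EFinB; congr EFin; ring.
have i1 : leb.-integrable setT (EFin \o (fun y => e / 2 * hk s z y)).
  rewrite (_ : _ \o _ = (fun y => (e / 2)%:E * (hk s z y)%:E)%E)//.
  exact: integrableZl.
have i2 : leb.-integrable setT (EFin \o (fun y => B * (corners (rate T) x y * F1 y))).
  rewrite (_ : _ \o _ = (fun y => B%:E * (corners (rate T) x y * F1 y)%:E)%E)//.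
  exact: integrableZl.
rewrite hE (le_lt_trans (le_normr_Rintegral _ ihd))//.
apply: (@le_lt_trans _ _ (\int[leb]_y (e / 2 * hk s z y + B * (corners (rate T) x y * F1 y)))).
  apply: le_Rintegral => //; first exact: integrable_norm.
  by rewrite (_ : _ \o _ = (fun y => (e / 2 * hk s z y)%:E +
    (B * (corners (rate T) x y * F1 y))%:E)%E)//; exact: integrableD.
rewrite RintegralD// RintegralZl// RintegralZl//.
rewrite {1}/Rintegral integral_heat_kernel//= mulr1.
by rewrite -/D [ltRHS]splitr ltrD2l (le_lt_trans (ler_norm _)).
Unshelve. all: by end_near. Qed.

End approximate_identity.

(** * Weak limit at the initial time *)

Section heat_flow_pairing.
Context (R : realType) (d : nat) (beta : R).
Hypothesis beta0 : 0 < beta.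
Local Notation rV := 'rV[R]_d.
Local Notation leb := (lebesgue_rV R d).
Local Notation peak := (peak d beta).
Local Notation rate := (rate beta).
Local Notation hk := (@heat_kernel R d beta).
Local Notation hc := (@heat_conv R d beta).
Implicit Types (x y z : rV) (F : rV -> R) (s t : R).

Lemma heat_kernelC t x y : hk t x y = hk t y x.
Proof. by rewrite !heat_kernelE gaussC. Qed.

(* Mean of a Brownian bridge from y to z, after time t of a total time s + t. *)
Definition bridge_mean s t y z : rV := (s + t)^-1 *: (t *: z + s *: y).

Lemma peak_mul s t : 0 < s -> 0 < t ->
  peak s * peak t = peak (s + t) * peak (s * t / (s + t)).
Proof.
move=> s0 t0; have st0 : 0 < s + t by rewrite addr_gt0.
have pb : 0 <= 4 * pi * beta by rewrite !mulr_ge0 ?pi_ge0// ltW.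
rewrite /peak -!invfM -!sqrtrM; last 2 first.
- by rewrite exprn_ge0// mulr_ge0// ltW.
- by rewrite exprn_ge0// mulr_ge0// ltW.
rewrite -!exprMn; congr (Num.sqrt (_ ^+ _))^-1.
move: (@pi_gt0 R); move: pi => p p0.
by field; rewrite gt_eqF.
Qed.

(** A two-step path from y through x to z has the density of its end point times the density of the
    bridge at x, of time parameter s t / (s + t). The exponents agree by completing the square in
    each coordinate. *)
Lemma heat_kernel_bridge s t x y z : 0 < s -> 0 < t ->
  hk s x z * hk t x y = hk (s + t) y z * hk (s * t / (s + t)) (bridge_mean s t y z) x.
Proof.
move=> s0 t0; have st0 : 0 < s + t by rewrite addr_gt0.
rewrite !heat_kernelE mulrACA [RHS]mulrACA peak_mul//; congr (_ * _).
rewrite -!expRD /sqdist; congr expR.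
rewrite !mulr_sumr -!sumrN -!big_split/=; apply: eq_bigr => i _.
by rewrite /rate /bridge_mean !mxE; field; rewrite !gt_eqF.
Qed.

Lemma heat_conv_EFin t F x : 0 < t -> gadm (rate t) F ->
  (hc t F x)%:E = (\int[leb]_y (hk t x y * F y)%:E)%E.
Proof.
move=> t0 aF; rewrite /heat_conv gt_eqF// /Rintegral fineK//.
apply: integrable_fin_num => //.
exact: (heat_conv_integrableP (beta := beta) x aF (lt0r_neq0 t0)).
Qed.

Lemma continuous_heat_conv t F : 0 < t -> gadm (rate t) F -> continuous (hc t F).
Proof.
move=> t0 aF x; rewrite (_ : hc t F = fun x => peak t * gint (rate t) x F); last first.
  by apply/funext => y; rewrite heat_convE// gt_eqF.
change (peak t * gint (rate t) y F @[y --> nbhs x] --> peak t * gint (rate t) x F).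
apply: cvgM; first exact: cvg_cst.
suff : gint (rate t) y F @[y --> within setT (nbhs x)] --> gint (rate t) x F.
  by move=> H U UF; have := H U UF; apply: (@filterS _ (nbhs x)) => y; exact.
apply: cvg_within_seq => u _ ux.
by apply: (cvg_gint (c0 := rate t)) => //; [exact/ltW/rate_gt0|exact: cvg_cst].
Qed.

Lemma heat_conv_ge0 t F x : 0 < t -> (forall y, 0 <= F y) -> 0 <= hc t F x.
Proof.
move=> t0 F0; rewrite /heat_conv gt_eqF//; apply: Rintegral_ge0 => y _.
by rewrite mulr_ge0// heat_kernel_ge0.
Qed.

Lemma heat_conv_le t F M x : 0 < t -> measurable_fun setT F ->
  (forall y, `|F y| <= M) -> hc t F x <= M.
Proof.
move=> t0 mF FM.
have aF : gadm (rate t) F by apply: (gadm_bounded beta0) => //; exists M.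
have M0 : 0 <= M by exact: le_trans (FM 0).
rewrite /heat_conv gt_eqF//.
have i1 : leb.-integrable setT (EFin \o (fun y => M * hk t x y)).
  rewrite (_ : _ \o _ = (fun y => M%:E * (hk t x y)%:E)%E)//.
  by apply: integrableZl => //; exact: integrable_heat_kernel.
apply: (@le_trans _ _ (\int[leb]_y (M * hk t x y))).
  apply: le_Rintegral => //.
    exact: (heat_conv_integrableP (beta := beta) x aF (lt0r_neq0 t0)).
  move=> y _; rewrite mulrC ler_wpM2r ?heat_kernel_ge0//.
  by rewrite (le_trans (ler_norm _)).
rewrite RintegralZl//; last exact: integrable_heat_kernel.
by rewrite {1}/Rintegral integral_heat_kernel// mulr1.
Qed.

Variables (T : R) (g h f : rV -> R) (M : R).
Hypotheses (T0 : 0 < T) (g0 : forall x, 0 <= g x) (h0 : forall x, 0 <= h x)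
  (f0 : forall x, 0 <= f x).
Hypotheses (ag : gadm (rate T) g) (ah : gadm (rate T) h).
Hypotheses (cf : continuous f) (fM : forall x, f x <= M).
Hypothesis fin : (\int[leb]_y (hc T g y * h y)%:E < +oo)%E.

Let mf : measurable_fun setT f. Proof. exact: continuous_measurable_rV. Qed.

Let M0 : 0 <= M. Proof. by rewrite (le_trans (f0 0)). Qed.

Let fM' x : `|f x| <= M. Proof. by rewrite ger0_norm. Qed.

Let agT t : 0 < t < T -> gadm (rate (T - t)) g.
Proof. by move=> t0T; apply: gadm_le ag; apply: le_rate => //; lra. Qed.

Let aht t : 0 < t < T -> gadm (rate t) h.
Proof. by move=> t0T; apply: gadm_le ah; apply: le_rate => //; lra. Qed.

(* J t y = G_t * (f psi_t) (y), which by heat_kernel_bridge is an average of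
   G_tau * f against G_T(y, z) g(z) dz (lemma JE). *)
Let J t y : \bar R := (\int[leb]_x (f x * hc (T - t) g x * hk t x y)%:E)%E.

Let W t y z := hc ((T - t) * t / T) f (bridge_mean (T - t) t y z).

Let JE t y : 0 < t < T ->
  J t y = (\int[leb]_z (W t y z * (hk T y z * g z))%:E)%E.
Proof.
move=> t0T; have /andP[t0 tT] := t0T.
have Tt0 : 0 < T - t by rewrite subr_gt0.
have m1 (s : R) : measurable_fun setT (fun p : rV * rV => hk s p.1 p.2).
  exact: measurable_heat_kernel.
have mky s : measurable_fun setT (fun x => hk s x y).
  under eq_fun do rewrite heat_kernelC.
  exact: (measurableT_comp (m1 s) (measurable_pair1 y)).
have mkx s x : measurable_fun setT (hk s x).
  exact: (measurableT_comp (m1 s) (measurable_pair1 x)).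
transitivity (\int[leb]_x \int[leb]_z (f x * (hk (T - t) x z * g z) * hk t x y)%:E)%E.
  apply: eq_integral => x _; rewrite mulrAC EFinM heat_conv_EFin//; last exact: agT.
  rewrite -ge0_integralZl//.
  - by apply: eq_integral => z _; rewrite -EFinM; congr EFin; ring.
  - by apply/measurable_EFinP; apply: measurable_funM => //; exact: ag.1.
  - by move=> z _; rewrite lee_fin mulr_ge0// heat_kernel_ge0.
  - by rewrite lee_fin mulr_ge0// heat_kernel_ge0.
rewrite (fubini_tonelli (m1 := leb) (m2 := leb)
  (fun p => (f p.1 * (hk (T - t) p.1 p.2 * g p.2) * hk t p.1 y)%:E)); last 2 first.
- apply/measurable_EFinP; apply: measurable_funM.
    apply: measurable_funM; first exact: (measurableT_comp mf measurable_fst).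
    by apply: measurable_funM => //; exact: (measurableT_comp ag.1 measurable_snd).
  exact: (measurableT_comp (mky t) measurable_fst).
- by move=> p; rewrite lee_fin !mulr_ge0// heat_kernel_ge0.
apply: eq_integral => z _.
have tau0 : 0 < (T - t) * t / T by rewrite divr_gt0// mulr_gt0.
rewrite mulrC EFinM /W heat_conv_EFin//; last first.
  by apply: (gadm_bounded beta0) => //; exists M.
rewrite -ge0_integralZl//.
- apply: eq_integral => x _; rewrite -EFinM; congr EFin.
  have := heat_kernel_bridge x y z Tt0 t0; rewrite subrK => e.
  transitivity (f x * g z * (hk (T - t) x z * hk t x y)); first by ring.
  by rewrite e; ring.
- apply/measurable_EFinP; apply: measurable_funM => //.
- by move=> x _; rewrite lee_fin mulr_ge0// heat_kernel_ge0.
- by rewrite lee_fin mulr_ge0// heat_kernel_ge0.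
Qed.

Let mJ t : 0 < t < T -> measurable_fun setT (J t).
Proof.
move=> t0T; have /andP[t0 tT] := t0T.
have Tt0 : 0 < T - t by rewrite subr_gt0.
apply: (measurable_fun_fubini_tonelli_G (m1 := leb)
  (fun p => (f p.1 * hc (T - t) g p.1 * hk t p.1 p.2)%:E)).
  apply/measurable_EFinP; apply: measurable_funM; last exact: measurable_heat_kernel.
  apply: measurable_funM; first exact: (measurableT_comp mf measurable_fst).
  apply: (measurableT_comp _ measurable_fst); apply: continuous_measurable_rV.
  by apply: continuous_heat_conv => //; exact: agT.
by move=> p; rewrite lee_fin !mulr_ge0 ?heat_conv_ge0 ?heat_kernel_ge0.
Qed.

Let W_bound t y z : 0 < t < T -> 0 <= W t y z <= M.
Proof.
move=> /andP[t0 tT].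
have tau0 : 0 < (T - t) * t / T by rewrite divr_gt0// mulr_gt0// subr_gt0.
by rewrite heat_conv_ge0//= heat_conv_le.
Qed.

Let J_ge0 t y : 0 < t < T -> (0 <= J t y)%E.
Proof.
move=> t0T; rewrite JE//; apply: integral_ge0 => z _.
by have /andP[w0 _] := W_bound y z t0T; rewrite lee_fin !mulr_ge0// heat_kernel_ge0.
Qed.

Let integrable_gT y : leb.-integrable setT (EFin \o (fun z => hk T y z * g z)).
Proof. exact: (heat_conv_integrableP (beta := beta) y ag (lt0r_neq0 T0)). Qed.

Let mW t y : 0 < t < T -> measurable_fun setT (W t y).
Proof.
move=> t0T; have /andP[t0 tT] := t0T.
have tau0 : 0 < (T - t) * t / T by rewrite divr_gt0// mulr_gt0// subr_gt0.
apply: continuous_measurable_rV => z.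
apply: (@continuous_comp _ _ _ (bridge_mean (T - t) t y) (hc ((T - t) * t / T) f)).
  apply: (@cvg_rV _ _ _ _ (nbhs_filter z)) => i.
  rewrite (_ : (fun z => _) = fun z => (T - t + t)^-1 * (t * z ord0 i + (T - t) * y ord0 i)); last first.
    by apply/funext => u; rewrite !mxE.
  rewrite (_ : bridge_mean _ _ _ _ _ _ = (T - t + t)^-1 * (t * z ord0 i + (T - t) * y ord0 i)); last first.
    by rewrite !mxE.
  have cz : {for z, continuous (fun z : rV => z ord0 i)} by exact: coord_continuous.
  have cc (k : R) : {for z, continuous (fun=> k : R)} by exact: cst_continuous.
  exact: continuousM (cc _) (continuousD (continuousM (cc t) cz) (cc _)).
by apply: continuous_heat_conv => //; apply: gadm_bounded => //; exists M.
Qed.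

Let J_le t y : 0 < t < T -> (J t y <= (M * hc T g y)%:E)%E.
Proof.
move=> t0T; rewrite JE// EFinM heat_conv_EFin// -ge0_integralZl//.
- apply: ge0_le_integral => //.
  + move=> z _; have /andP[w0 _] := W_bound y z t0T.
    by rewrite lee_fin !mulr_ge0// heat_kernel_ge0.
  + apply/measurable_EFinP; apply: measurable_funM; first exact: mW.
    by have /measurable_int/measurable_EFinP := integrable_gT y.
  + by apply: measurable_funeM; exact: measurable_int (integrable_gT y).
  + move=> z _; have /andP[_ wM] := W_bound y z t0T.
    by rewrite -EFinM lee_fin ler_wpM2r// mulr_ge0// heat_kernel_ge0.
- exact: measurable_int (integrable_gT y).
- by move=> z _; rewrite lee_fin mulr_ge0// heat_kernel_ge0.
Qed.

Lemma heat_pairingE t : 0 < t < T ->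
  (\int[leb]_x (f x * (hc (T - t) g x * hc t h x))%:E =
   \int[leb]_y ((h y)%:E * J t y))%E.
Proof.
move=> t0T; have /andP[t0 tT] := t0T.
have Tt0 : 0 < T - t by rewrite subr_gt0.
have mhc : measurable_fun setT (hc (T - t) g).
  by apply: continuous_measurable_rV; apply: continuous_heat_conv => //; exact: agT.
have m1 : measurable_fun setT (fun p : rV * rV => hk t p.1 p.2).
  exact: measurable_heat_kernel.
have mkx x : measurable_fun setT (hk t x).
  exact: (measurableT_comp m1 (measurable_pair1 x)).
have mky y : measurable_fun setT (fun x => hk t x y).
  by under eq_fun do rewrite heat_kernelC; exact: mkx.
transitivity (\int[leb]_x \int[leb]_y (f x * hc (T - t) g x * (hk t x y * h y))%:E)%E.
  apply: eq_integral => x _; rewrite mulrA EFinM (heat_conv_EFin _ t0); last exact: aht.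
  rewrite -ge0_integralZl//.
  - by apply/measurable_EFinP; apply: measurable_funM => //; exact: ah.1.
  - by move=> y _; rewrite lee_fin mulr_ge0// heat_kernel_ge0.
  - by rewrite lee_fin mulr_ge0// heat_conv_ge0.
rewrite (fubini_tonelli (m1 := leb) (m2 := leb)
  (fun p => (f p.1 * hc (T - t) g p.1 * (hk t p.1 p.2 * h p.2))%:E)); last 2 first.
- apply/measurable_EFinP; apply: measurable_funM.
    by apply: measurable_funM; [exact: (measurableT_comp mf measurable_fst)
                               |exact: (measurableT_comp mhc measurable_fst)].
  by apply: measurable_funM => //; exact: (measurableT_comp ah.1 measurable_snd).
- by move=> p; rewrite lee_fin !mulr_ge0 ?heat_conv_ge0 ?heat_kernel_ge0.
apply: eq_integral => y _; rewrite /J -ge0_integralZl//.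
- by apply: eq_integral => x _; rewrite -EFinM; congr EFin; rewrite /=; ring.
- apply/measurable_EFinP; apply: measurable_funM => //; exact: measurable_funM.
- by move=> x _; rewrite lee_fin !mulr_ge0 ?heat_conv_ge0 ?heat_kernel_ge0.
- by rewrite lee_fin.
Qed.

Let mhcT : measurable_fun setT (hc T g).
Proof. by apply: continuous_measurable_rV; exact: continuous_heat_conv. Qed.

Let integrable_hcT : leb.-integrable setT (EFin \o (fun y => M * (hc T g y * h y))).
Proof.
rewrite (_ : _ \o _ = (fun y => M%:E * (hc T g y * h y)%:E)%E)//.
apply: integrableZl => //; apply/integrableP; split.
  by apply/measurable_EFinP; apply: measurable_funM => //; exact: ah.1.
rewrite (eq_integral (fun y => (hc T g y * h y)%:E))// => y _.
by rewrite /= ger0_norm// mulr_ge0// heat_conv_ge0.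
Qed.

(** A majorant free of t, since averages of [f] stay below [M]; it is integrable by [fin]. In the
    application it is M rho0. *)
Let hJ_bound t y : 0 < t < T ->
  (`|(h y)%:E * J t y| <= (M * (hc T g y * h y))%:E)%E.
Proof.
move=> t0T; rewrite gee0_abs ?mule_ge0 ?lee_fin ?J_ge0//.
apply: (@le_trans _ _ ((h y)%:E * (M * hc T g y)%:E)%E).
  by apply: lee_wpmul2l; rewrite ?lee_fin ?J_le.
by rewrite -EFinM lee_fin; lra.
Qed.

Lemma integrable_heat_pairing t : 0 < t < T ->
  leb.-integrable setT (EFin \o (fun x => f x * (hc (T - t) g x * hc t h x))).
Proof.
move=> t0T; have /andP[t0 tT] := t0T.
have Tt0 : 0 < T - t by rewrite subr_gt0.
apply/integrableP; split.
  apply/measurable_EFinP; apply: measurable_funM => //; apply: measurable_funM.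
    by apply: continuous_measurable_rV; apply: continuous_heat_conv => //; exact: agT.
  by apply: continuous_measurable_rV; apply: continuous_heat_conv => //; exact: aht.
rewrite (eq_integral (fun x => (f x * (hc (T - t) g x * hc t h x))%:E)); last first.
  by move=> x _; rewrite /= ger0_norm// !mulr_ge0// heat_conv_ge0.
rewrite heat_pairingE//; have /integrableP[_] := integrable_hcT.
apply: le_lt_trans; apply: ge0_le_integral => //.
- by move=> y _; rewrite mule_ge0 ?lee_fin ?J_ge0.
- by apply: emeasurable_funM; [apply/measurable_EFinP; exact: ah.1|exact: mJ].
- by apply: measurableT_comp => //; exact: measurable_int integrable_hcT.
- by move=> y _; exact: (le_trans (lee_abs _) (le_trans (hJ_bound y t0T) (lee_abs _))).
Qed.

(** Two nested dominated convergences: in y with majorant [hJ_bound], and for each y in z with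
    majorant M G_T(y, z) g(z). The inner limit is f(y), because the time of the bridge kernel tends
    to 0 while its mean tends to y. *)
Lemma cvg_heat_pairing (d1 : (1 <= d)%N) (t_ : nat -> R) :
  (forall n, 0 < t_ n < T) -> t_ @ \oo --> (0 : R) ->
  (\int[leb]_x (f x * (hc (T - t_ n) g x * hc (t_ n) h x)%R)%:E)%E @[n --> \oo] -->
  (\int[leb]_x (f x * (hc T g x * h x))%:E)%E.
Proof.
move=> t0T t_0.
rewrite (_ : (fun n => _) = (fun n => \int[leb]_y ((h y)%:E * J (t_ n) y))%E); last first.
  by apply/funext => n; rewrite heat_pairingE.
apply: (@dominated_cvg _ _ _ _ _ measurableT _ _
   (EFin \o (fun y => M * (hc T g y * h y)))) => //=.
- by move=> n; apply: emeasurable_funM; [apply/measurable_EFinP; exact: ah.1|exact: mJ].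
- move=> y _.
  rewrite (_ : f y * (hc T g y * h y) = h y * (f y * hc T g y)); last by ring.
  rewrite EFinM; apply: cvgeZl => //.
  rewrite (_ : (fun n => J (t_ n) y) =
    (fun n => \int[leb]_z (W (t_ n) y z * (hk T y z * g z))%:E)%E); last first.
    by apply/funext => n; rewrite JE.
  have -> : (f y * hc T g y)%:E = (\int[leb]_z (f y * (hk T y z * g z))%:E)%E.
    rewrite EFinM heat_conv_EFin// -ge0_integralZl ?lee_fin//.
    - exact: measurable_int (integrable_gT y).
    - by move=> z _; rewrite lee_fin mulr_ge0// heat_kernel_ge0.
  apply: (@dominated_cvg _ _ _ _ _ measurableT _ _
     (EFin \o (fun z => M * (hk T y z * g z)))) => //=.
  + move=> n; apply/measurable_EFinP; apply: measurable_funM; first exact: mW.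
    by have /measurable_int/measurable_EFinP := integrable_gT y.
  + move=> z _; apply: cvg_EFin; first exact: nearW.
    apply: cvgM; last exact: cvg_cst.
    have af : gadm (rate T) f by apply: (gadm_bounded beta0) => //; exists M.
    have cfy : {for y, continuous f} by exact: cf.
    have C := cvg_heat_conv0 beta0 d1 T0 af cfy.
    pose u n : R * rV := ((T - t_ n) * t_ n / T, bridge_mean (T - t_ n) (t_ n) y z).
    have u0 : u @ \oo --> within [set p | 0 < p.1 <= T] (nbhs ((0 : R), y)).
      have : u @ \oo --> nbhs ((0 : R), y).
        apply: (@cvg_pair _ _ _ _ (nbhs (0 : R)) (nbhs y)).
          rewrite [X in _ --> nbhs X](_ : 0 = (T - 0) * 0 / T); last first.
            by rewrite mulr0 mul0r.
          apply: cvgM; last exact: cvg_cst.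
          by apply: cvgM => //; apply: cvgB => //; exact: cvg_cst.
        apply: cvg_rV => i.
        rewrite [X in _ --> X](_ : y ord0 i = T^-1 * (0 * z ord0 i + (T - 0) * y ord0 i)); last first.
          by field; rewrite gt_eqF.
        rewrite (_ : (fun n => _) = (fun n => T^-1 * (t_ n * z ord0 i + (T - t_ n) * y ord0 i))).
          apply: cvgM; first exact: cvg_cst.
          apply: cvgD; apply: cvgM => //; try exact: cvg_cst.
          by apply: cvgB => //; exact: cvg_cst.
        by apply/funext => n; rewrite !mxE subrK.
      move=> uu A /uu[N _ NA]; exists N => // n /NA; apply => /=.
      have /andP[tn0 tnT] := t0T n.
      rewrite divr_gt0 ?mulr_gt0 ?subr_gt0//= ler_pdivrMr//.
      by apply: ler_pM; lra.
    exact: (cvg_comp _ _ u0 C).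
  + rewrite (_ : _ \o _ = (fun z => M%:E * (hk T y z * g z)%:E)%E)//.
    by apply: integrableZl => //; exact: integrable_gT.
  + move=> n z _; have /andP[w0 wM] := W_bound y z (t0T n).
    rewrite lee_fin ger0_norm ?mulr_ge0 ?heat_kernel_ge0//.
    by rewrite ler_wpM2r// mulr_ge0// heat_kernel_ge0.
- by move=> n y _; exact: hJ_bound.
Qed.

End heat_flow_pairing.

(** * Hopf-Cole transformation *)

Section hopf_cole.
Context (R : realType) (d : nat) (beta T : R).
Local Notation rV := 'rV[R]_d.
Variables (psi psit : R -> rV -> R) (psix : 'I_d -> R -> rV -> R)
  (psixx : 'I_d -> 'I_d -> R -> rV -> R).
Variables (phi phit : R -> rV -> R) (phix : 'I_d -> R -> rV -> R)
  (phixx : 'I_d -> 'I_d -> R -> rV -> R).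
Hypothesis psiC : C12_with T psi psit psix psixx.
Hypothesis phiC : C12_with T phi phit phix phixx.
Hypothesis psi_gt0 : forall t x, 0 < t < T -> 0 < psi t x.
Hypothesis psi_heat : forall t x, 0 < t < T ->
  psit t x = - (beta * \sum_i psixx i i t x).
Hypothesis phi_heat : forall t x, 0 < t < T ->
  phit t x = beta * \sum_i phixx i i t x.

Let rho t x := psi t x * phi t x.
Let Phi t x := 2 * beta * ln (psi t x).

Let rhoC := C12_with_mul psiC phiC.
Let PhiC := C12_with_ln (2 * beta) psi_gt0 psiC.

Lemma hopf_cole_C12 : is_C12 T rho /\ is_C12 T Phi.
Proof. by split; [exact: C12_withP rhoC|exact: C12_withP PhiC]. Qed.

(** The flux simplifies: rho grad Phi = 2 beta phi grad psi, as psi cancels the denominator of grad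
    ln psi. Its divergence, 2 beta (phi lap psi + grad psi . grad phi), combines with the two heat
    equations to beta lap (psi phi). *)
Lemma hopf_cole_continuity t x : 0 < t < T ->
  derive1 (fun s => rho s x) t
    + divergence (fun y => rho t y *: grad (Phi t) y) x
  = beta * laplacian (rho t) x.
Proof.
move=> t0T.
rewrite (C12_with_derive1 rhoC t0T) (C12_with_laplacian rhoC t0T).
rewrite /divergence (eq_bigr (fun i => 2 * beta *
    (phi t x * psixx i i t x + psix i t x * phix i t x))); last first.
  move=> i _; have [_ p1 p2 _] := psiC x t0T; have [_ q1 _ _] := phiC x t0T.
  rewrite (_ : (fun y => _) = 2 * beta \*: (phi t * psix i t)).
    have D := is_deriveZ (2 * beta) (is_deriveM (q1 i) (p2 i i)).
    exact: derive_val.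
  apply/funext => y; rewrite mxE (C12_with_grad PhiC t0T).
  have p0 := psi_gt0 y t0T.
  rewrite /rho /= mulrfctE /GRing.scale/=.
  by field; rewrite gt_eqF.
rewrite psi_heat// phi_heat// -mulr_sumr !big_split/= -!mulr_sumr.
have -> : \sum_i phix i t x * psix i t x = \sum_i psix i t x * phix i t x.
  by apply: eq_bigr => i _; rewrite mulrC.
by ring.
Qed.

(** The quadratic part of the Laplacian of ln psi cancels half the squared gradient of Phi exactly
    because of the factor 2 beta; what is left is the backward heat equation divided by psi. *)
Lemma hopf_cole_HJ t x : 0 < t < T ->
  derive1 (fun s => Phi s x) t + 2^-1 * enorm (grad (Phi t) x) ^+ 2
  = - (beta * laplacian (Phi t) x).
Proof.
move=> t0T.
rewrite (C12_with_derive1 PhiC t0T) (C12_with_laplacian PhiC t0T).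
rewrite /enorm sqr_sqrtr; last by apply: sumr_ge0 => i _; exact: sqr_ge0.
rewrite (eq_bigr (fun i => (2 * beta) ^+ 2 * (psi t x)^-1 ^+ 2 * psix i t x ^+ 2)); last first.
  by move=> i _; rewrite (C12_with_grad PhiC t0T); ring.
rewrite -!mulr_sumr sumrB -mulr_sumr.
rewrite [X in _ = - (beta * (2 * beta * (_ - X)))](_ : _ =
    (psi t x)^-1 ^+ 2 * \sum_i psix i t x ^+ 2); last first.
  by rewrite mulr_sumr; apply: eq_bigr => i _; ring.
by rewrite psi_heat//; field; rewrite gt_eqF// psi_gt0.
Qed.

End hopf_cole.

(** * Regularity of the heat flow up to the end times *)

Section heat_conv_regularity.
Context (R : realType) (d : nat) (beta : R).
Hypothesis beta0 : 0 < beta.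
Local Notation rV := 'rV[R]_d.
Local Notation rate := (rate beta).
Local Notation hc := (@heat_conv R d beta).
Implicit Types (x : rV) (F : rV -> R) (t : R).

(** Agreement on the open time interval is enough, derivatives in t being local; [heat_conv] follows
    a separate convention at t = 0. *)
Lemma C12_with_eq T (u u' ut : R -> rV -> R) ux uxx :
  (forall t x, 0 < t < T -> u t x = u' t x) ->
  C12_with T u ut ux uxx -> C12_with T u' ut ux uxx.
Proof.
move=> uu' uC t x t0T; have [D1 D2 D3 C] := uC t x t0T; split => //.
- apply: near_eq_is_derive D1.
  have h : \forall s \near t, 0 < s < T.
    have := near_time x t0T => -[[A B] /= [tA xB] AB].
    by apply: filterS tA => s As; apply: (AB (s, x)); split => //; exact: nbhs_singleton.
  by apply: filterS h => s; exact: uu'.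
- by move=> i; rewrite (_ : u' t = u t)//; apply/funext => y; rewrite uu'.
- move=> w [->|wt|wx|wxx]; last 3 first.
  + by apply: C; constructor 2.
  + by apply: C; constructor 3.
  + by apply: C; constructor 4.
  apply: near_continuous_for (C u _); last by constructor 1.
  by apply: filterS (near_time x t0T) => p p0T; rewrite uu'.
Qed.

Lemma heat_conv_C12 T F : 0 < T -> gadm (rate T) F ->
  C12_with T (fun t => hc t F) (heat_t beta F) (heat_x beta F) (heat_xx beta F).
Proof.
move=> T0 aF; apply: C12_with_eq (heat_C12 beta0 T0 aF) => t x /andP[t0 tT].
by rewrite heat_convE ?gt_eqF//; apply: gadm_le aF; rewrite le_rate// t0 ltW.
Qed.

Lemma within_heat_conv T F t x : gadm (rate T) F -> 0 < t ->
  hc p.1 F p.2 @[p --> within [set p | 0 < p.1 <= T] (nbhs (t, x))] --> hc t F x.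
Proof.
move=> aF t0; apply: cvg_within_seq => u uT ut.
have u1 : (u n).1 @[n --> \oo] --> t by apply: (cvg_comp _ _ ut); exact: cvg_fst.
have u2 : (u n).2 @[n --> \oo] --> x by apply: (cvg_comp _ _ ut); exact: cvg_snd.
have tT : t <= T by apply: (cvgr_to_le u1); apply: nearW => n; have /andP[] := uT n.
have T0 : 0 < T by exact: lt_le_trans tT.
have ar s : 0 < s <= T -> gadm (rate s) F by move=> sT; apply: gadm_le aF; exact: le_rate.
rewrite heat_convE ?gt_eqF//; last by apply: ar; rewrite t0.
rewrite (_ : (fun n => _) = (fun n => peak d beta (u n).1 * gint (rate (u n).1) (u n).2 F)).
  apply: cvgM; first by apply: (cvg_comp _ _ u1); exact: continuous_peak.
  apply: (@cvg_gint _ _ (rate T) F (fun n => rate (u n).1) (fun n => (u n).2)) => //.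
  - exact/ltW/rate_gt0.
  - by move=> n; apply: le_rate => //; exact: (uT n).
  - by apply: (cvg_comp _ _ u1); exact: continuous_rate.
apply/funext => n; have un : 0 < (u n).1 <= T := uT n.
by rewrite heat_convE//; [case/andP: un => u0 _; rewrite gt_eqF|exact: ar].
Qed.

(** At t = 0 there are two ways to approach: along time 0 itself, where the convention G_0 * F = F
    leaves the continuity of [F], and through positive times, by [cvg_heat_conv0]. *)
Lemma within_heat_conv0 (d1 : (1 <= d)%N) T F t x : 0 < T -> gadm (rate T) F ->
  continuous F -> 0 <= t ->
  hc p.1 F p.2 @[p --> within [set p | 0 <= p.1 <= T] (nbhs (t, x))] --> hc t F x.
Proof.
move=> T0 aF cF; rewrite le_eqVlt => /orP[/eqP<-|t0] U.
  rewrite {1}/heat_conv eqxx => FU.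
  have cFx : {for x, continuous F} by exact: cF.
  have H1 : \forall p \near ((0 : R), x), 0 < p.1 <= T -> U (hc p.1 F p.2).
    exact: (cvg_heat_conv0 beta0 d1 T0 aF cFx FU).
  have H2 : \forall p \near ((0 : R), x), U (F p.2).
    have h : \forall y \near x, U (F y) by exact: cFx.
    exact: (cvg_snd h).
  change (\forall p \near ((0 : R), x), 0 <= p.1 <= T -> U (hc p.1 F p.2)).
  near=> p.
  have Up : U (F p.2) by near: p.
  have Up' : 0 < p.1 <= T -> U (hc p.1 F p.2) by near: p.
  move=> /andP[p0 pT]; move: p0; rewrite le_eqVlt => /orP[/eqP p0|p0].
    by rewrite /heat_conv -p0 eqxx.
  by apply: Up'; rewrite p0.
move=> FU.
have H1 : \forall p \near (t, x), 0 < p.1 <= T -> U (hc p.1 F p.2).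
  exact: (within_heat_conv (x := x) aF t0 FU).
have H2 : \forall p \near (t, x), 0 < p.1.
  have h : \forall s \near t, 0 < s by exact: lt_nbhsr.
  exact: (cvg_fst h).
change (\forall p \near (t, x), 0 <= p.1 <= T -> U (hc p.1 F p.2)).
near=> p.
have p0 : 0 < p.1 by near: p.
have Up : 0 < p.1 <= T -> U (hc p.1 F p.2) by near: p.
by move=> /andP[_ pT]; apply: Up; rewrite p0.
Unshelve. all: by end_near. Qed.

Lemma within_time_rev T t x :
  (T - p.1, p.2) @[p --> within [set p : R * rV | 0 <= p.1 <= T] (nbhs (t, x))] -->
  within [set p : R * rV | 0 <= p.1 <= T] (nbhs (T - t, x)).
Proof.
have C : (T - p.1, p.2) @[p --> nbhs (t, x)] --> nbhs (T - t, x).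
  apply: (@cvg_pair _ _ _ _ (nbhs (T - t)) (nbhs x) _ _ _ (fun p => T - p.1) snd);
    last exact: cvg_snd.
  by apply: cvgB; [exact: cvg_cst|exact: cvg_fst].
move=> A AT; have H : \forall p \near (T - t, x), 0 <= p.1 <= T -> A p by exact: AT.
have H' : \forall p \near (t, x), 0 <= T - p.1 <= T -> A (T - p.1, p.2) by exact: C H.
change (\forall p \near (t, x), 0 <= p.1 <= T -> A (T - p.1, p.2)).
by apply: filterS H' => p h pT; apply: h; lra.
Qed.

End heat_conv_regularity.

(** * Solution of the system *)

Lemma powR_half_sqrt (R : realType) (a : R) n :
  0 <= a -> a `^ (n%:R / 2) = Num.sqrt (a ^+ n).
Proof. by move=> a0; rewrite powRrM powR_mulrn// powR12_sqrt// exprn_ge0. Qed.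

Section schroedinger_system.
Context (R : realType) (d : nat) (T beta : R) (V rho0 : 'rV[R]_d -> R).
Hypotheses (d1 : (1 <= d)%N) (T0 : 0 < T) (beta0 : 0 < beta).
Hypothesis cV : continuous V.
Hypothesis rho0P : probability_density rho0.
Hypothesis finV : (forall y : 'rV[R]_d,
     \int[lebesgue_rV R d]_z
       (expR (- (2 * beta)^-1 * (V z + enorm (z - y) ^+ 2 / (2 * T))))%:E
     < +oo)%E.
Local Notation rV := 'rV[R]_d.
Local Notation leb := (lebesgue_rV R d).
Local Notation rate := (rate beta).
Local Notation peak := (peak d beta).
Local Notation hc := (@heat_conv R d beta).

Let g : rV -> R := fun x => expR (- (V x / (2 * beta))).
Let h : rV -> R := fun x => rho0 x / hc T g x.

Let g_gt0 x : 0 < g x. Proof. exact: expR_gt0. Qed.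

Let g_ge0 x : 0 <= g x. Proof. exact: expR_ge0. Qed.

Let cg : continuous g.
Proof.
move=> x; have cVx : {for x, continuous V} by exact: cV.
have cc : {for x, continuous (fun=> (2 * beta)^-1 : R)} by exact: cst_continuous.
by apply: (continuous_comp (continuousN (continuousM cVx cc))); exact: continuous_expR.
Qed.

Lemma expR_gaussE (t : R) (x z : rV) : t != 0 ->
  expR (- (2 * beta)^-1 * (V z + enorm (x - z) ^+ 2 / (2 * t))) =
  gauss (rate t) x z * g z.
Proof.
move=> t0; rewrite enorm_sqdist -expRD; congr expR; rewrite /rate.
by field; rewrite t0 gt_eqF.
Qed.

(** This is the integrability hypothesis on V, rewritten through [expR_gaussE]. *)
Let ag : gadm (rate T) g.
Proof.
split=> [|x]; first exact: continuous_measurable_rV.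
apply/integrableP; split.
  apply/measurable_EFinP; apply: measurable_funM; first exact: measurable_gaussr.
  exact: continuous_measurable_rV.
apply: le_lt_trans (finV x); rewrite le_eqVlt; apply/orP; left; apply/eqP.
apply: eq_integral => z _.
rewrite /= ger0_norm; last by rewrite mulr_ge0// gauss_ge0.
by rewrite -(expR_gaussE _ _ (lt0r_neq0 T0)) !enorm_sqdist sqdistC.
Qed.

Let agt t : 0 < t <= T -> gadm (rate t) g.
Proof. by move=> tT; apply: gadm_le ag; exact: le_rate. Qed.

Let lower_bound t x : 0 < t <= T ->
  exists2 C, 0 < C & forall y, C * gauss (rate t) x y <= hc t g y.
Proof.
move=> tT; have /andP[t0 _] := tT.
have cgx : {for x, continuous g} by exact: cg.
have [C C0 CP] := gint_lower_bound (rate_gt0 beta0 t0) g_ge0 (g_gt0 x) cgx (agt tT).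
have p0 := peak_gt0 d beta0 t0.
exists (peak t * C) => [|y]; first by rewrite mulr_gt0.
by rewrite heat_convE ?gt_eqF//; [rewrite -mulrA ler_pM2l|exact: agt].
Qed.

Let psi_gt0 t x : 0 <= t <= T -> 0 < hc t g x.
Proof.
move=> /andP[]; rewrite le_eqVlt => /orP[/eqP<- _|t0 tT].
  by rewrite /heat_conv eqxx.
have [|C C0 /(_ x)] := @lower_bound t x; first by rewrite t0.
by apply: lt_le_trans; rewrite mulr_gt0// expR_gt0.
Qed.

Let psiT_gt0 x : 0 < hc T g x. Proof. by apply: psi_gt0; rewrite lexx ltW. Qed.

Let h_ge0 x : 0 <= h x.
Proof. by have [_ r0 _] := rho0P; rewrite divr_ge0// ltW. Qed.

Let irho0 : leb.-integrable setT (EFin \o rho0).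
Proof.
have [mr r0 r1] := rho0P; apply/integrableP; split; first exact/measurable_EFinP.
rewrite (eq_integral (fun x => (rho0 x)%:E)) ?r1 ?ltry// => x _.
by rewrite /= ger0_norm.
Qed.

Let mh : measurable_fun setT h.
Proof.
have [mr _ _] := rho0P; apply: measurable_funM => //.
apply: continuous_measurable_rV => x.
have cx : {for x, continuous (hc T g)} by exact: continuous_heat_conv.
by apply: (continuousV _ cx); rewrite gt_eqF.
Qed.

(** By [lower_bound], gauss (rate T) x y * h y <= C^-1 rho0 y, with [C] depending on x only, and
    rho0 has mass one. *)
Let ah : gadm (rate T) h.
Proof.
split=> // x.
have [|C C0 CP] := @lower_bound T x; first by rewrite T0 lexx.
have iC := integrableZl measurableT C^-1 irho0.
apply: (le_integrable measurableT) iC => /=.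
  by apply/measurable_EFinP; apply: measurable_funM => //; exact: measurable_gaussr.
move=> y _; rewrite lee_fin; have [_ r0 _] := rho0P.
rewrite ger0_norm; last by rewrite mulr_ge0// gauss_ge0.
rewrite ger0_norm; last by rewrite mulr_ge0// invr_ge0 ltW.
rewrite /h mulrCA mulrC ler_wpM2r//.
by rewrite ler_pdivrMr// ler_pdivlMl.
Qed.

Let aht t : 0 < t <= T -> gadm (rate t) h.
Proof. by move=> tT; apply: gadm_le ah; exact: le_rate. Qed.

Let rho t x := hc (T - t) g x * hc t h x.
Let Phi t x := 2 * beta * ln (hc (T - t) g x).

Lemma schroedinger_admissible t x : 0 <= t <= T ->
  [/\ heat_conv_integrable beta (T - t) g x, 0 < hc (T - t) g x &
      heat_conv_integrable beta t h x].
Proof.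
move=> /andP[t0 tT]; split.
- move=> Tt0; apply: (heat_conv_integrableP _ (agt _) Tt0).
  by rewrite lt_def Tt0 subr_ge0 tT gerBl.
- by apply: psi_gt0; rewrite subr_ge0 tT gerBl.
- move=> tn0; apply: (heat_conv_integrableP _ (aht _) tn0).
  by rewrite lt_def tn0 t0.
Qed.

Let psiC := C12_with_rev (heat_conv_C12 beta0 T0 ag).
Let phiC := heat_conv_C12 beta0 T0 ah.

Let rev_gt0 t (x : rV) : 0 < t < T -> 0 < hc (T - t) g x.
Proof. by move=> t0T; apply: psi_gt0; lra. Qed.

Let psi_heat t x : 0 < t < T -> - heat_t beta g (T - t) x =
  - (beta * \sum_i heat_xx beta g i i (T - t) x).
Proof. by move=> t0T; rewrite heat_equation//; lra. Qed.

Let phi_heat t x : 0 < t < T -> heat_t beta h t x =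
  beta * \sum_i heat_xx beta h i i t x.
Proof. by move=> t0T; rewrite heat_equation//; lra. Qed.

Let psi_cont t x : 0 <= t <= T ->
  hc (T - p.1) g p.2 @[p --> within [set p : R * rV | 0 <= p.1 <= T] (nbhs (t, x))]
  --> hc (T - t) g x.
Proof.
move=> /andP[t0 tT].
apply: (cvg_comp _ (fun p => hc p.1 g p.2) (@within_time_rev R d T t x)).
by apply: within_heat_conv0 => //; rewrite subr_ge0.
Qed.

Lemma rho_continuous :
  {within `]0, T] `*` [set: rV], continuous (fun p : R * rV => rho p.1 p.2)}.
Proof.
have -> : `]0, T] `*` [set: rV] = [set p : R * rV | 0 < p.1 <= T].
  by apply/seteqP; split => p /=; rewrite in_itv/=; [case|].
apply/subspace_continuousP => -[t x] /= /andP[t0 tT].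
apply: cvgM; last exact: within_heat_conv.
have H := @psi_cont t x; move=> U /H; rewrite (ltW t0) tT => /(_ isT) UH.
have {}UH : \forall p \near (t, x), 0 <= p.1 <= T -> U (hc (T - p.1) g p.2) by exact: UH.
change (\forall p \near (t, x), 0 < p.1 <= T -> U (hc (T - p.1) g p.2)).
by apply: filterS UH => p pU /andP[p0 pT]; apply: pU; rewrite ltW.
Qed.

Lemma Phi_continuous :
  {within `[0, T] `*` [set: rV], continuous (fun p : R * rV => Phi p.1 p.2)}.
Proof.
have -> : `[0, T] `*` [set: rV] = [set p : R * rV | 0 <= p.1 <= T].
  by apply/seteqP; split => p /=; rewrite in_itv/=; [case|].
apply/subspace_continuousP => -[t x] /= t0T.
apply: cvgM; first exact: cvg_cst.
have p0 : 0 < hc (T - t) g x by apply: psi_gt0; lra.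
by apply: (continuous_cvg _ (continuous_ln p0)); exact: psi_cont.
Qed.

Let hpsiE x : hc T g x * h x = rho0 x.
Proof. by rewrite /h mulrC divfK// gt_eqF. Qed.

Let fin : (\int[leb]_y (hc T g y * h y)%:E < +oo)%E.
Proof.
have [_ _ r1] := rho0P.
by rewrite (eq_integral (fun y => (rho0 y)%:E)) ?r1 ?ltry// => y _; rewrite hpsiE.
Qed.

Lemma rho_weak_cvg_ge0 (f : rV -> R) (M : R) (t_ : nat -> R) :
  continuous f -> (forall x, 0 <= f x <= M) ->
  (forall n, 0 < t_ n < T) -> t_ @ \oo --> (0 : R) ->
  \int[leb]_x (f x * rho (t_ n) x) @[n --> \oo] --> \int[leb]_x (f x * rho0 x).
Proof.
move=> cf fM t0T t_0.
have f0 x : 0 <= f x by case/andP: (fM x).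
have fM' x : f x <= M by case/andP: (fM x).
have H := cvg_heat_pairing beta0 T0 g_ge0 h_ge0 f0 ag ah cf fM' fin d1 t0T t_0.
apply: fine_cvg.
rewrite fineK.
  rewrite (eq_integral (fun x => (f x * (hc T g x * h x))%:E)); first exact: H.
  by move=> x _; rewrite hpsiE.
apply: integrable_fin_num => //.
have iM := integrableZl measurableT M irho0.
apply: (le_integrable measurableT) iM => /=.
  apply/measurable_EFinP; apply: measurable_funM; first exact: continuous_measurable_rV.
  by have [] := rho0P.
move=> x _; have [_ r0 _] := rho0P.
by rewrite lee_fin normrM [leRHS]normrM ler_wpM2r// ger0_norm// (le_trans (fM' x))// ler_norm.
Qed.

(** The Tonelli argument wants nonnegative test functions: f is written as (f + M) - M, and both the
    sum and the constant M fall under [rho_weak_cvg_ge0]. *)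
Lemma rho_weak_cvg (f : rV -> R) (M : R) (t_ : nat -> R) :
  continuous f -> (forall x, `|f x| <= M) ->
  (forall n, 0 < t_ n < T) -> t_ @ \oo --> (0 : R) ->
  \int[leb]_x (f x * rho (t_ n) x) @[n --> \oo] --> \int[leb]_x (f x * rho0 x).
Proof.
move=> cf fM t0T t_0.
have M0 : 0 <= M by exact: le_trans (fM 0).
pose f1 x := f x + M.
have cf1 : continuous f1.
  move=> x; have cfx : {for x, continuous f} by exact: cf.
  have cc : {for x, continuous (fun=> M : R)} by exact: cst_continuous.
  exact: (continuousD cfx cc).
have f1M x : 0 <= f1 x <= M + M.
  by have := fM x; rewrite ler_norml /f1 => /andP[? ?]; apply/andP; split; lra.
have cM : continuous (fun _ : rV => M) by exact: cst_continuous.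
have MM (x : rV) : 0 <= M <= M by rewrite M0 lexx.
have C1 := rho_weak_cvg_ge0 cf1 f1M t0T t_0.
have C2 := rho_weak_cvg_ge0 cM MM t0T t_0.
have i1 n : leb.-integrable setT (EFin \o (fun x => f1 x * rho (t_ n) x)).
  apply: (integrable_heat_pairing beta0 T0 g_ge0 h_ge0 _ ag ah cf1 (M := M + M) _ fin (t0T n)).
    by move=> x; case/andP: (f1M x).
  by move=> x; case/andP: (f1M x).
have i2 n : leb.-integrable setT (EFin \o (fun x => M * rho (t_ n) x)).
  exact: (integrable_heat_pairing beta0 T0 g_ge0 h_ge0 (fun=> M0) ag ah cM (fun=> lexx M) fin (t0T n)).
have j2 : leb.-integrable setT (EFin \o (fun x => M * rho0 x)).
  exact: (integrableZl measurableT M irho0).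
have j1 : leb.-integrable setT (EFin \o (fun x => f1 x * rho0 x)).
  have iM := integrableZl measurableT (M + M) irho0.
  have [mr r0 _] := rho0P.
  apply: (le_integrable measurableT) iM => /=.
    by apply/measurable_EFinP; apply: measurable_funM => //; exact: continuous_measurable_rV.
  move=> x _; have /andP[f10 f1M'] := f1M x.
  by rewrite lee_fin normrM [leRHS]normrM ler_wpM2r// ger0_norm// (le_trans f1M')// ler_norm.
have -> : \int[leb]_x (f x * rho0 x) =
    \int[leb]_x (f1 x * rho0 x) - \int[leb]_x (M * rho0 x).
  by rewrite -RintegralB//; apply: eq_Rintegral => x _; rewrite /f1; ring.
rewrite (_ : (fun n => _) = (fun n => \int[leb]_x (f1 x * rho (t_ n) x) -
    \int[leb]_x (M * rho (t_ n) x))); first exact: cvgB.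
apply/funext => n; rewrite -RintegralB//.
by apply: eq_Rintegral => x _; rewrite /f1; ring.
Qed.

Lemma schroedinger_solution : is_solution T beta V rho0 rho Phi.
Proof.
split.
- exact: (hopf_cole_C12 beta psiC phiC rev_gt0).
- move=> t x t0T; split.
    exact: (hopf_cole_continuity psiC phiC rev_gt0 psi_heat phi_heat).
  exact: (hopf_cole_HJ psiC rev_gt0 psi_heat).
- move=> x; split.
    by rewrite /rho subr0 [hc 0 h x]/heat_conv eqxx hpsiE.
  rewrite /Phi subrr [hc 0 g x]/heat_conv eqxx /g expRK.
  by field; rewrite gt_eqF.
- by split; [exact: rho_continuous|exact: Phi_continuous].
(* Only the tail of the sequence lies below T, where the pairing is controlled; the first N terms
   are dropped. *)
- move=> f cf [M fM]; apply/cvg_at_rightP => u [u0 u_0].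
  have [N _ NT] : \forall n \near \oo, u n < T by exact: (cvgr_lt _ u_0).
  rewrite -(cvg_shiftn N).
  apply: (rho_weak_cvg (t_ := fun n => u (n + N)%N) cf fM); last by rewrite cvg_shiftn.
  by move=> n; rewrite u0/=; apply: NT; rewrite /= leq_addl.
Qed.

(** The integrand splits into a function of z times a function of y. The denominator is (G_T * g)(y)
    without its factor [peak T], so one [peak T] appears, and by [peak_mul] it combines with the
    prefactor, [peak (t * (T - t) / T)], into [peak (T - t) * peak t]. *)
Lemma rho_formula t x : 0 < t < T ->
  (rho t x)%:E =
  (((4 * pi * beta * (t * (T - t) / T)) `^ (d%:R / 2))^-1%:E *
   \int[leb]_z \int[leb]_y
     (expR (- (2 * beta)^-1 *
              (V z + enorm (x - z) ^+ 2 / (2 * (T - t))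
                   + enorm (x - y) ^+ 2 / (2 * t)))
      / (\int[leb]_w
           expR (- (2 * beta)^-1 *
                   (V w + enorm (y - w) ^+ 2 / (2 * T))))%R
      * rho0 y)%:E)%E.
Proof.
move=> t0T; have /andP[t0 tT] := t0T.
have Tt0 : 0 < T - t by rewrite subr_gt0.
have agT : gadm (rate (T - t)) g by apply: agt; lra.
have ahT : gadm (rate t) h by apply: aht; lra.
have pT := peak_gt0 d beta0 T0.
have inner z : (\int[leb]_y
     (expR (- (2 * beta)^-1 *
              (V z + enorm (x - z) ^+ 2 / (2 * (T - t))
                   + enorm (x - y) ^+ 2 / (2 * t)))
      / (\int[leb]_w
           expR (- (2 * beta)^-1 *
                   (V w + enorm (y - w) ^+ 2 / (2 * T))))%R
      * rho0 y)%:E =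
   (peak T * gint (rate t) x h)%:E * (gauss (rate (T - t)) x z * g z)%:E)%E.
  rewrite -EFinM /gint EFinM EFinM fineK; last by apply: integrable_fin_num => //; exact: ahT.2.
  rewrite muleAC -EFinM -ge0_integralZl//; last 3 first.
  - exact: measurable_int (ahT.2 x).
  - by move=> y _; rewrite lee_fin mulr_ge0// gauss_ge0.
  - rewrite lee_fin; apply: (mulr_ge0 (ltW pT)).
    exact: (mulr_ge0 (gauss_ge0 _ _ _) (g_ge0 z)).
  apply: eq_integral => y _; rewrite -EFinM; congr EFin.
  have -> : \int[leb]_w expR (- (2 * beta)^-1 * (V w + enorm (y - w) ^+ 2 / (2 * T))) =
      gint (rate T) y g.
    by apply: eq_Rintegral => w _; rewrite expR_gaussE// gt_eqF.
  have -> : expR (- (2 * beta)^-1 * (V z + enorm (x - z) ^+ 2 / (2 * (T - t))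
      + enorm (x - y) ^+ 2 / (2 * t))) =
      gauss (rate (T - t)) x z * g z * gauss (rate t) x y.
    rewrite -expR_gaussE ?gt_eqF// [gauss (rate t) x y]/gauss -expRD; congr expR.
    by rewrite !enorm_sqdist /rate; field; rewrite !gt_eqF.
  rewrite /h heat_convE ?gt_eqF//.
  have I0 : 0 < gint (rate T) y g.
    by have := psiT_gt0 y; rewrite heat_convE ?gt_eqF// pmulr_rgt0.
  by field; rewrite !gt_eqF.
under eq_integral do rewrite inner.
rewrite ge0_integralZl//; last 3 first.
- exact: measurable_int (agT.2 x).
- by move=> z _; rewrite lee_fin mulr_ge0// gauss_ge0.
- rewrite lee_fin; apply: (mulr_ge0 (ltW pT)).
  by apply: Rintegral_ge0 => y _; rewrite mulr_ge0// gauss_ge0.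
have -> : (\int[leb]_z (gauss (rate (T - t)) x z * g z)%:E = (gint (rate (T - t)) x g)%:E)%E.
  by rewrite /gint fineK//; apply: integrable_fin_num => //; exact: agT.2.
rewrite -!EFinM; congr EFin.
rewrite powR_half_sqrt; last by rewrite !mulr_ge0 ?pi_ge0 ?invr_ge0 ?ltW.
rewrite /rho !heat_convE ?gt_eqF//.
have -> : (Num.sqrt ((4 * pi * beta * (t * (T - t) / T)) ^+ d))^-1 =
    peak (t * (T - t) / T) by [].
have := peak_mul d beta0 Tt0 t0; rewrite subrK [(T - t) * t]mulrC => e.
rewrite mulrACA e; move: (peak _) (peak _) (gint _ _ _) (gint _ _ _) => a b u v.
by ring.
Qed.

Lemma Phi_formula t x : 0 <= t < T ->
  Phi t x =
  2 * beta *
  ln (\int[leb]_y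
        (((4 * pi * beta * (T - t)) `^ (d%:R / 2))^-1 *
         expR (- (2 * beta)^-1 *
                 (V y + enorm (x - y) ^+ 2 / (2 * (T - t)))))).
Proof.
move=> /andP[t0 tT]; have Tt0 : 0 < T - t by rewrite subr_gt0.
have n0 : (T - t == 0) = false by rewrite gt_eqF.
rewrite /Phi /heat_conv n0; congr (2 * beta * ln _).
apply: eq_Rintegral => y _; rewrite expR_gaussE ?gt_eqF// heat_kernelE.
by rewrite powR_half_sqrt ?mulrA// !mulr_ge0 ?pi_ge0// ltW.
Qed.

End schroedinger_system.

Unset Implicit Arguments.

Theorem proposition4 (R : realType) (d : nat) (T beta : R)
    (V rho0 : 'rV[R]_d -> R) :
  (1 <= d)%N -> 0 < T -> 0 < beta ->
  continuously_differentiable V ->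
  probability_density rho0 -> finite_second_moment rho0 ->
  (forall y : 'rV[R]_d,
     \int[lebesgue_rV R d]_z
       (expR (- (2 * beta)^-1 * (V z + enorm (z - y) ^+ 2 / (2 * T))))%:E
     < +oo)%E ->
  let g : 'rV[R]_d -> R := fun x => expR (- (V x / (2 * beta))) in
  let h : 'rV[R]_d -> R := fun x => rho0 x / heat_conv beta T g x in
  let rho : R -> 'rV[R]_d -> R :=
    fun t x => heat_conv beta (T - t) g x * heat_conv beta t h x in
  let Phi : R -> 'rV[R]_d -> R :=
    fun t x => 2 * beta * ln (heat_conv beta (T - t) g x) in
  [/\ (forall t x, 0 <= t <= T ->
         [/\ heat_conv_integrable beta (T - t) g x,
             0 < heat_conv beta (T - t) g x &
             heat_conv_integrable beta t h x]),
      is_solution T beta V rho0 rho Phi,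
      (forall t x, 0 < t < T ->
         (rho t x)%:E =
         (((4 * pi * beta * (t * (T - t) / T)) `^ (d%:R / 2))^-1%:E *
          \int[lebesgue_rV R d]_z \int[lebesgue_rV R d]_y
            (expR (- (2 * beta)^-1 *
                     (V z + enorm (x - z) ^+ 2 / (2 * (T - t))
                          + enorm (x - y) ^+ 2 / (2 * t)))
             / (\int[lebesgue_rV R d]_w
                  expR (- (2 * beta)^-1 *
                          (V w + enorm (y - w) ^+ 2 / (2 * T))))%R
             * rho0 y)%:E)%E) &
      (forall t x, 0 <= t < T ->
         Phi t x =
         2 * beta *
         ln (\int[lebesgue_rV R d]_y
               (((4 * pi * beta * (T - t)) `^ (d%:R / 2))^-1 *
                expR (- (2 * beta)^-1 *
                        (V y + enorm (x - y) ^+ 2 / (2 * (T - t)))))))].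
Proof.
move=> d1 T0 beta0 [dV _] rho0P _ finV.
have cV : continuous V by move=> x; exact: differentiable_continuous.
split.
- by move=> t x; exact: schroedinger_admissible.
- exact: schroedinger_solution.
- by move=> t x; exact: rho_formula.
- by move=> t x; exact: Phi_formula.
Qed.
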